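(* Assume that $\vartheta\ge1$. The sequence of probability measures on $[0,+\infty)$ $$\frac1n\sum_{x:\,\mathcal{G}^{(3)}_{n,\vartheta n}(x)=0}\delta_{-x},\qquad n\in\mathbb{N}$$ (sum over the zeros counted with multiplicities; these zeros are all real and nonpositive), converges weakly to a probability measure $\mathcal{Z}^{\vartheta}$ on $[0,\infty)$ with the Stieltjes transform $$\int_{[0,\infty)}\frac{\mathcal{Z}^{\vartheta}(dx)}{t-x}=\frac{\vartheta}{t}-\frac{\vartheta^2}{t(t+1)}\cdot\frac{W_0\left(\frac{-t^{-1}-1}{\vartheta e^{1/\vartheta}}\right)}{1+\vartheta W_0\left(\frac{-t^{-1}-1}{\vartheta e^{1/\vartheta}}\right)},\qquad t\in\mathbb{C}\setminus[0,\infty)$$ (with the removable singularity at $t=-1$ removed).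
   Context: $\genfrac{\{}{\}}{0pt}{}{n}{k}$ are the Stirling numbers of the second kind. For $n\in\mathbb{N}$, $\theta>0$ put $\mathcal{G}^{(3)}_{n,\theta}(t)=\sum_{k=1}^n\genfrac{\{}{\}}{0pt}{}{n}{k}\frac{\theta(\theta-1)\cdots(\theta-k+1)}{\theta^n}t^k$. For $\theta>n-1$ it is a polynomial of degree $n$ and the probability generating function of the Stirling–Sibuya distribution. $W_0$ is the principal branch of the Lambert $W$-function: the analytic function on $\mathbb{C}\setminus(-\infty,-1/e]$ with $W_0(z)e^{W_0(z)}=z$ whose restriction to $(-1/e,\infty)$ is the inverse of $w\mapsto we^w$, $w\in(-1,\infty)$. *)

(* Defs.v *)
From HB Require Import structures.
From mathcomp Require Import all_boot all_order all_algebra.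
From mathcomp Require Import all_classical all_reals all_analysis.
From mathcomp Require Import complex.
Set Implicit Arguments.
Unset Strict Implicit.
Unset Printing Implicit Defensive.
Import Order.TTheory GRing.Theory Num.Theory.
Import numFieldNormedType.Exports.
Local Open Scope classical_set_scope.
Local Open Scope ring_scope.
Local Open Scope complex_scope.

Definition stirling2 (n k : nat) : nat :=
  #|[set P : {set {set 'I_n}} | finset.partition P [set: 'I_n]%SET & #|P| == k]%SET|.

Definition G3 (R : realType) (n : nat) (theta : R) : {poly R} :=
  \sum_(1 <= k < n.+1)
    ((stirling2 n k)%:R * (\prod_(j < k) (theta - j%:R)) / theta ^+ n) *: 'X^k.

(* The complex zeros of a real polynomial, listed with multiplicities. *)
Definition czeros (R : realType) (p : {poly R}) : seq R[i] :=
  sval (closed_field_poly_normal (map_poly (real_complex R) p)).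

(* 1/n times the sum of the Dirac masses at - Re z, z ranging over czeros p.
   The real part only serves to obtain a point of R: it is used for polynomials
   all of whose zeros are real. *)
Definition zero_measure (R : realType) (n : nat) (p : {poly R}) :
    {measure set (measurableTypeR R) -> \bar R} :=
  mscale (n%:R^-1)%:nng
    (msum (fun j : nat =>
             dirac (- complex.Re (czeros p)`_j : measurableTypeR R))
          (size (czeros p))).

(* Measures on [0, +oo) are Borel measures on R with no mass on ]-oo, 0[. *)
Definition prob_on_nonneg (R : realType)
    (mu : {measure set (measurableTypeR R) -> \bar R}) : Prop :=
  mu [set: R] = 1%E /\ mu `[0, +oo[%classic = 1%E.

Definition weak_cvg_nonneg (R : realType)
    (mu : nat -> {measure set (measurableTypeR R) -> \bar R})
    (nu : {measure set (measurableTypeR R) -> \bar R}) : Prop :=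
  forall f : R -> R,
    {within `[0, +oo[%classic, continuous f} ->
    (exists M : R, forall x, 0 <= x -> `|f x| <= M) ->
    (\int[mu n]_(x in `[0%R, +oo[%classic) (f x)%:E)%E @[n --> \oo] -->
    (\int[nu]_(x in `[0%R, +oo[%classic) (f x)%:E)%E.

(* For complex t, ~~ (0 <= t) says that t is not a nonnegative real number:
   the order of R[i] compares only numbers with equal imaginary parts. *)
Definition stieltjes (R : realType)
    (nu : {measure set (measurableTypeR R) -> \bar R}) (t : R[i]) : R[i] :=
  (\int[nu]_(x in `[0, +oo[%classic) complex.Re (1 / (t - x%:C)))%R +i*
  (\int[nu]_(x in `[0, +oo[%classic) complex.Im (1 / (t - x%:C)))%R.

Definition cexp (R : realType) (z : R[i]) : R[i] :=
  (expR (complex.Re z))%:C * (cos (complex.Im z) +i* sin (complex.Im z)).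

(* The complement of the real half-line ]-oo, -1/e]. *)
Definition lambert_domain (R : realType) : set R[i] :=
  [set z | ~ (complex.Im z = 0 /\ complex.Re z <= - expR (-1))].

(* The values of W outside lambert_domain are irrelevant. In lambertW0_analytic
   derivability is over the field R[i], i.e. complex differentiability. *)
Record is_lambertW0 (R : realType) (W : R[i] -> R[i]) : Prop := {
  lambertW0_analytic :
    forall z, lambert_domain z -> derivable (W : R[i]^o -> R[i]^o) z 1;
  lambertW0_eq : forall z, lambert_domain z -> W z * cexp (W z) = z;
  lambertW0_real : forall x : R, - expR (-1) < x ->
    exists2 w : R, -1 < w & W x%:C = w%:C;
  lambertW0_inv : forall w : R, -1 < w -> W (w * expR w)%:C = w%:C
}.

Definition limit_stieltjes (R : realType) (W : R[i] -> R[i]) (vartheta : R)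
    (t : R[i]) : R[i] :=
  let w := W ((- t^-1 - 1) / (vartheta * expR vartheta^-1)%:C) in
  vartheta%:C / t
  - (vartheta ^+ 2)%:C / (t * (t + 1)) * (w / (1 + vartheta%:C * w)).

(* Main.v *)
(* Write Q_m for the numerator of G3 m theta (with Q_0 = 1), so that
   Q_(m+1) = theta X Q_m + X (1 - X) Q_m'.  Off the half-line t <= 0 the ratio
   Q_(m+1)(t) / (theta Q_m(t)) equals t (1 + (1 - t) / theta * sum_x 1 / (t + x)), the sum
   being over the zeros - x of Q_m; for m <= theta a half-plane argument keeps it away
   from 0, hence Q_(m+1) again has only zeros <= 0.
   Expanding (1 - X) Q_(n+1) binomially in theta Q_j - Q_(j+1), and using that consecutive
   ratios differ by O(1/n), one sees that every limit a of the ratios for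
   theta = vartheta n, m = n satisfies (1 - t) a = t exp(1 / (vartheta a)) (1 - a); in terms
   of w = (1 - a) / (vartheta a) this reads w e^w = (1/t - 1) / (vartheta e^(1/vartheta)).
   For 0 < t < 1 the relevant w is a nonnegative real, so the ratios converge.  This gives
   the limits of the means of 1 / (t + x), then those of the powers of y = 1 / (1 + x), and
   by Bernstein approximation those of the Lipschitz functions of y.  The quantile functions
   of y therefore converge off a countable set, and Z is the law of their limit; no mass
   escapes to infinity because of a bound on the limit of the means of (1 + x) / (t + x) as
   t tends to infinity.  Finally w and W0 (z), where z = w e^w, agree for all t: they agree
   at t = 1, and w e^w is locally injective away from w = -1, which allows one to
   continue the equality along the segment from 1 to t. *)
Require Import Defs.
From HB Require Import structures.
From mathcomp Require Import all_boot all_order all_algebra.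
From mathcomp Require Import all_classical all_reals all_analysis.
From mathcomp Require Import complex.
From mathcomp Require Import measurable_realfun ring lra.
Import Order.TTheory GRing.Theory Num.Theory.
Import numFieldNormedType.Exports.
Set Implicit Arguments.
Unset Strict Implicit.
Unset Printing Implicit Defensive.
Local Open Scope classical_set_scope.
Local Open Scope ring_scope.
Local Open Scope complex_scope.
Local Notation normc := Normc.normc.

(** * Stirling numbers of the second kind *)

(** The proof works with the kernel [1 / (t + x)] on the complement of ]-oo, 0]; the sign is changed
    to [1 / (t - x)] only at the end. The half-plane argument rests on [m <= theta]: then the ratio
    divided by t is a convex combination of 1 and of the numbers [(1 + x) / (t + x)], all in one
    open half-plane. The resulting lower bound on the ratio depends on t alone, so it serves twice:
    for real-rootedness, and as the uniform control of the error terms in the binomial expansion.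
    The obstacle is that [w e^w = z] has in general infinitely many complex solutions, so the
    limiting equation alone does not force convergence. Hence only real t in ]0, 1[ are used to
    build the limit law; elsewhere the branch is selected afterwards, by continuity of the Stieltjes
    transform of the law already obtained. That law is the image of the uniform law on [0, 1] under
    a limit of quantile functions, so that weak convergence becomes an instance of dominated
    convergence. *)

Lemma card_ffun_kernel (T U : finType) (P : {set {set T}}) :
  finset.partition P [set: T]%SET ->
  #|[set f : {ffun T -> U} | preim_partition f [set: T] == P]%SET| =
  (#|U| ^_ #|P|)%N.
Proof.
move=> partP; have [/eqP defD tiP nP0] := and3P partP.
have inP (x : T) : finset.pblock P x \in P by rewrite pblock_mem// defD inE.
pose blk (x : T) : {B | B \in P} := exist _ (finset.pblock P x) (inP x).
(* Functions with kernel [P] correspond to injections from the set of blocks of [P]: each is such an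
   injection composed with [blk]. *)
pose F (g : {ffun {B | B \in P} -> U}) : {ffun T -> U} := [ffun x => g (blk x)].
have blkP (b : {B | B \in P}) : exists x, blk x == b.
  case: b => B PB; have /set0Pn[x Bx] : B != finset.set0 := memPn nP0 B PB.
  by exists x; apply/eqP/val_inj => /=; exact: def_pblock Bx.
have F_inj : injective F.
  move=> g h /ffunP e; apply/ffunP => b; have [x /eqP <-] := blkP b.
  by have := e x; rewrite !ffunE.
have -> : #|P| = #|{: {B | B \in P}}| by rewrite card_sig.
rewrite -card_inj_ffuns -(card_imset _ F_inj); apply: eq_card => f.
rewrite !inE; apply/eqP/imsetP => [ker_f|[g]].
  have pblockE x y : (f x == f y) = (y \in finset.pblock P x).
    rewrite -ker_f pblock_equivalence_partition ?inE//.
    by split=> // /eqP ->.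
  pose g : {ffun {B | B \in P} -> U} := [ffun b => f (xchoose (blkP b))].
  have gE x : g (blk x) = f x.
    rewrite ffunE; apply/esym/eqP; rewrite pblockE.
    have /eqP/(congr1 val)/= <- := xchooseP (blkP (blk x)).
    by rewrite mem_pblock defD inE.
  exists g; last by apply/ffunP => x; rewrite ffunE gE.
  rewrite inE; apply/injectiveP => b c; have [x /eqP <-] := blkP b; have [y /eqP <-] := blkP c.
  rewrite !gE => /eqP; rewrite pblockE => yx; apply: val_inj => /=.
  exact/esym/same_pblock.
rewrite inE => /injectiveP g_inj ->.
rewrite -[RHS](preim_partition_pblock partP).
apply: eq_imset => x; apply/setP => y; rewrite !inE !ffunE.
by apply/eqP/eqP => [/g_inj/(congr1 val)//|e]; congr (g _); apply: val_inj.
Qed.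

Lemma card_partition_le (T : finType) (P : {set {set T}}) :
  finset.partition P [set: T]%SET -> (#|P| <= #|T|)%N.
Proof.
move=> partP; rewrite -[#|T|]cardsT (card_partition partP).
rewrite -[#|P|]muln1 -sum_nat_const.
by apply: leq_sum => B PB; rewrite card_gt0 (partition_neq0 partP).
Qed.

(** Counts the [N ^ n] functions from an n-set to an N-set by their kernel, then by the number of
    blocks of the kernel. *)
Lemma sum_stirling2_ffact (n N : nat) :
  (\sum_(k < n.+1) stirling2 n k * N ^_ k = N ^ n)%N.
Proof.
rewrite -[in RHS](card_ord N) -[in RHS](card_ord n) -card_ffun -sum1_card.
rewrite (partition_big (fun f : {ffun 'I_n -> 'I_N} => preim_partition f [set: 'I_n]%SET)
  (fun P => finset.partition P [set: 'I_n]%SET)) /=; last first.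
  by move=> f _; exact: preim_partitionP.
rewrite (partition_big (fun P : {set {set 'I_n}} => inord #|P| : 'I_n.+1) predT)//=.
apply: eq_bigr => k _; rewrite /stirling2 -sum1_card big_distrl /=.
apply: eq_big => [P|P].
  rewrite inE; case: (boolP (finset.partition _ _)) => //= partP.
  by rewrite -val_eqE /= inordK// ltnS (leq_trans (card_partition_le partP)) ?card_ord.
rewrite inE => /andP[partP /eqP cardP].
by rewrite mul1n -cardP -[in LHS](card_ord N) -(card_ffun_kernel _ partP) -sum1dep_card.
Qed.

(** The system is triangular: at [N = k] the terms beyond k vanish and the k-th one has the factor
    [k!]. *)
Lemma ffact_lin_indep (n : nat) (a b : nat -> nat) :
  (forall N, \sum_(k < n) a k * N ^_ k = \sum_(k < n) b k * N ^_ k)%N ->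
  forall k, (k < n)%N -> a k = b k.
Proof.
move=> e; elim/ltn_ind => k IH kn; have := e k.
have split (c : nat -> nat) :
    (\sum_(j < n) c j * k ^_ j = \sum_(j < k) c j * k ^_ j + c k * k`!)%N.
  rewrite -(subnKC kn) big_split_ord /= [X in (_ + X)%N]big1 ?addn0 => [|j _].
    by rewrite big_ord_recr /= ffactnn.
  by rewrite ffact_small ?muln0// ltn_addr.
rewrite !split (eq_bigr (fun j : 'I_k => b j * k ^_ j)%N) => [/addnI/eqP|j _].
  by rewrite eqn_pmul2r ?fact_gt0// => /eqP.
by rewrite IH// (ltn_trans _ kn).
Qed.

Lemma stirling2_gt (n k : nat) : (n < k)%N -> stirling2 n k = 0%N.
Proof.
move=> nk; apply: eq_card0 => P; rewrite !inE; apply/negP => /andP[partP /eqP cardP].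
by have := card_partition_le partP; rewrite cardP card_ord leqNgt nk.
Qed.

(** No bijection on partitions is used: both sides are the coefficients of [N ^ n.+1] in the falling
    factorials, by [N * N ^_ j = N ^_ j.+1 + j * N ^_ j]. *)
Lemma stirling2S (n k : nat) :
  stirling2 n.+1 k = (k * stirling2 n k + (if k is j.+1 then stirling2 n j else 0))%N.
Proof.
pose b k := (k * stirling2 n k + (if k is j.+1 then stirling2 n j else 0))%N.
have [kn|kn] := ltnP k n.+2; last first.
  rewrite stirling2_gt//; case: k kn => // k kn; rewrite ltnS in kn.
  by rewrite !stirling2_gt ?muln0// ltnW.
apply: (@ffact_lin_indep n.+2 (stirling2 n.+1) b) kn => N.
rewrite sum_stirling2_ffact expnS -sum_stirling2_ffact big_distrr /=.
under [RHS]eq_bigr do rewrite /b mulnDl.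
rewrite big_split /= [X in (X + _)%N]big_ord_recr /= (@stirling2_gt n n.+1)// muln0 addn0.
rewrite [X in (_ + X)%N]big_ord_recl /= mul0n add0n -big_split /=.
apply: eq_bigr => j _; rewrite /bump /= add1n ffactnSr.
rewrite [(j * _)%N]mulnC -mulnA -mulnDr mulnCA; congr (_ * _)%N.
have [jN|jN] := leqP j N; last by rewrite ffact_small ?muln0.
by rewrite [in RHS](mulnC (N ^_ j)) -mulnDl subnKC.
Qed.

(** * The polynomials sum_k S(n, k) theta (theta - 1) ... (theta - k + 1) X^k *)

Section SibuyaPoly.
Variable F : comNzRingType.
Implicit Types theta t : F.

(** The polynomial Q_n of the overview, over an arbitrary ring so that it serves for real and for
    complex [theta]. *)
Fixpoint sibuya_poly theta (n : nat) : {poly F} :=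
  if n is m.+1 then
    theta *: ('X * sibuya_poly theta m) + 'X * (1 - 'X) * (sibuya_poly theta m)^`()
  else 1.

Lemma coef_sibuya_poly theta n k :
  (sibuya_poly theta n)`_k = (stirling2 n k)%:R * \prod_(j < k) (theta - j%:R).
Proof.
elim: n k => [|n IH] k.
  rewrite /= coef1; case: k => [|k]; last by rewrite stirling2_gt// mul0r.
  have := sum_stirling2_ffact 0 0; rewrite big_ord1 ffactn0 muln1 expn0 => ->.
  by rewrite big_ord0 mulr1.
rewrite stirling2S /= (_ : 'X * _ * _ = 'X * (sibuya_poly theta n)^`() -
  'X * ('X * (sibuya_poly theta n)^`())); last by ring.
rewrite coefD coefZ coefB !coefXM.
case: k => [|k] /=; first by rewrite mul0n addn0 mul0r mulr0 subrr addr0.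
rewrite !coef_deriv natrD natrM mulrDl !IH big_ord_recr /=.
case: k => [|k] /=; first by rewrite mulr1n mul1r; ring.
ring.
Qed.

Lemma horner_sibuya_polyS theta n t :
  (sibuya_poly theta n.+1).[t] =
  t * (theta * (sibuya_poly theta n).[t] + (1 - t) * (sibuya_poly theta n)^`().[t]).
Proof. by rewrite /= !hornerE /=; ring. Qed.

Lemma horner_deriv_sibuya_polyS theta n t (p := sibuya_poly theta n) :
  (sibuya_poly theta n.+1)^`().[t] =
  theta * p.[t] + theta * t * p^`().[t] + (1 - t *+ 2) * p^`().[t]
  + t * (1 - t) * p^`()^`().[t].
Proof.
rewrite /= !(derivD, derivN, derivZ, derivM, derivX, derivC) !hornerE /= -/p.
by ring.
Qed.

(* With L p = theta X p + X (1 - X) p', the sum below is (1 + L)^n (theta - L) 1. *)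
Lemma sibuya_poly_convolution theta n :
  (1 - 'X) * sibuya_poly theta n.+1 =
  'X * \sum_(j < n.+1) 'C(n, j)%:R *:
    (theta *: sibuya_poly theta j - sibuya_poly theta j.+1).
Proof.
pose L (p : {poly F}) := theta *: ('X * p) + 'X * (1 - 'X) * p^`().
pose d j := theta *: sibuya_poly theta j - sibuya_poly theta j.+1.
have LZ a p : L (a *: p) = a *: L p.
  by rewrite /L derivZ -!mul_polyC; ring.
have LD p q : L (p + q) = L p + L q by rewrite /L derivD -!mul_polyC; ring.
have L0 : L 0 = 0 by rewrite /L deriv0 !mulr0 scaler0 addr0.
have LS j : L (sibuya_poly theta j) = sibuya_poly theta j.+1 by [].
have Ld j : L (d j) = d j.+1.
  by rewrite /d LD LZ -scaleN1r LZ !LS scaleN1r.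
pose V n := \sum_(j < n.+1) 'C(n, j)%:R *: d j.
(* Pascal's rule: [V] is multiplied by [1 + L] at each step. *)
have VS m : V m.+1 = V m + L (V m).
  rewrite /V big_ord_recl /= bin0.
  under eq_bigr => j _ do rewrite /bump /= add1n binS natrD scalerDl.
  rewrite big_split /= addrA; congr (_ + _).
    rewrite big_ord_recr /= bin_small// scale0r addr0 [RHS]big_ord_recl bin0.
    by congr (_ + _); apply: eq_bigr => j _.
  rewrite (big_morph L LD L0); apply: eq_bigr => j _.
  by rewrite LZ Ld.
rewrite -/(V n); elim: n => [|n IH].
  by rewrite /V big_ord1 bin0 /d /= derivC -!mul_polyC; ring.
have -> : sibuya_poly theta n.+2 = L (sibuya_poly theta n.+1) by [].
(* [L] is a first order differential operator; its commutators with the multiplications by ['X] and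
   [1 - 'X] are the multiplications by ['X * (1 - 'X)] and by its opposite, and these corrections
   cancel in the induction. *)
have LX p : L ('X * p) = 'X * L p + 'X * (1 - 'X) * p.
  by rewrite /L derivM derivX -!mul_polyC; ring.
have L1X p : L ((1 - 'X) * p) = (1 - 'X) * L p - 'X * (1 - 'X) * p.
  by rewrite /L derivM derivB derivX derivC -!mul_polyC; ring.
rewrite VS [RHS]mulrDr -IH.
have -> : 'X * L (V n) = L ('X * V n) - (1 - 'X) * ('X * V n) by rewrite LX; ring.
by rewrite -IH L1X; ring.
Qed.

End SibuyaPoly.

Lemma map_sibuya_poly (F K : comNzRingType) (f : {rmorphism F -> K}) theta n :
  map_poly f (sibuya_poly theta n) = sibuya_poly (f theta) n.
Proof.
apply/polyP => k; rewrite coef_map !coef_sibuya_poly /= rmorphM rmorph_nat rmorph_prod.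
by congr (_ * _); apply: eq_bigr => j _; rewrite rmorphB rmorph_nat.
Qed.

Lemma size_sibuya_poly (F : fieldType) (theta : F) n :
  (forall j, (j < n)%N -> theta != j%:R) -> size (sibuya_poly theta n) = n.+1.
Proof.
move=> thetaj; apply/anti_leq/andP; split.
  by apply/leq_sizeP => k kn; rewrite coef_sibuya_poly stirling2_gt// mul0r.
have Snn m : stirling2 m m = 1%N.
  elim: m => [|m IH]; last by rewrite stirling2S stirling2_gt// muln0 IH.
  by have := sum_stirling2_ffact 0 0; rewrite big_ord1 ffactn0 muln1.
rewrite ltnNge; apply/negP => /leq_sizeP/(_ n (leqnn n))/eqP.
rewrite coef_sibuya_poly Snn mul1r; apply/negP/prodf_neq0 => j _.
by rewrite subr_eq0 thetaj.
Qed.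

(** For [n > 0] the term [k = 0], absent from [G3], vanishes because S(n, 0) = 0. For [n = 0] the
    sum in [G3] is empty, while [sibuya_poly theta 0] is 1. *)
Lemma G3E (R : realType) n (theta : R) : (0 < n)%N ->
  G3 n theta = (theta ^+ n)^-1 *: sibuya_poly theta n.
Proof.
move=> n0; apply/polyP => k; rewrite /G3 coef_sum coefZ coef_sibuya_poly.
under eq_bigr do rewrite coefZ coefXn.
have [kn|kn] := boolP (1 <= k < n.+1)%N; last first.
  rewrite big_nat big1 => [|j jn]; last first.
    by rewrite (_ : (k == j) = false) ?mulr0//; apply: contraNF kn => /eqP ->.
  suff -> : stirling2 n k = 0%N by rewrite mul0r mulr0.
  case: k kn => [|k]; first by case: (n) n0 => // m _ _; rewrite stirling2S.
  by rewrite /= -leqNgt; exact: stirling2_gt.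
rewrite (bigD1_seq k) ?mem_index_iota ?iota_uniq//= eqxx mulr1.
rewrite [X in _ + X]big1 ?addr0 => [|j jk]; first by rewrite mulrC.
by rewrite eq_sym (negPf jk) mulr0.
Qed.

(** * The slit plane *)

Section ComplexModulus.
Variable R : realType.
Implicit Types (x y : R) (z u v t : R[i]).

Lemma normr_normc z : `|z| = (normc z)%:C.
Proof. by rewrite normc_def; case: z. Qed.

Lemma sqr_normcE z : normc z ^+ 2 = complex.Re z ^+ 2 + complex.Im z ^+ 2.
Proof. by case: z => a b /=; rewrite sqr_sqrtr// addr_ge0 ?sqr_ge0. Qed.

Lemma normc_ge0 z : 0 <= normc z.
Proof. by case: z => a b /=; rewrite sqrtr_ge0. Qed.

Lemma normc_eq0 z : (normc z == 0) = (z == 0).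
Proof. by apply/eqP/eqP => [/Normc.eq0_normc//|->]; rewrite Normc.normc0. Qed.

Lemma normc_gt0 z : (0 < normc z) = (z != 0).
Proof. by rewrite lt_def normc_ge0 andbT normc_eq0. Qed.

Lemma normcR x : normc x%:C = `|x|.
Proof. by rewrite /= expr0n/= addr0 sqrtr_sqr. Qed.

Lemma normcX z n : normc (z ^+ n) = normc z ^+ n.
Proof.
elim: n => [|n IH]; first by rewrite !expr0 Normc.normc1.
by rewrite !exprS Normc.normcM IH.
Qed.

Lemma ler_normcD u v : normc (u + v) <= normc u + normc v.
Proof. exact: le_normcD. Qed.

Lemma ler_normcB u v : normc (u - v) <= normc u + normc v.
Proof. by rewrite -(normcN v); exact: le_normcD. Qed.

Lemma normcBC u v : normc (u - v) = normc (v - u).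
Proof. by rewrite -normcN opprB. Qed.

Lemma ler_normc_sum I (s : seq I) (P : pred I) (F : I -> R[i]) :
  normc (\sum_(i <- s | P i) F i) <= \sum_(i <- s | P i) normc (F i).
Proof.
elim/big_ind2: _ => // [|u x v y ux vy]; first by rewrite Normc.normc0.
by rewrite (le_trans (le_normcD _ _))// lerD.
Qed.

Lemma ler_normRe z : `|complex.Re z| <= normc z.
Proof.
rewrite -(@ler_pXn2r _ 2)// ?nnegrE ?normc_ge0// sqr_normcE real_normK ?num_real//.
by rewrite lerDl sqr_ge0.
Qed.

Lemma ler_normIm z : `|complex.Im z| <= normc z.
Proof.
rewrite -(@ler_pXn2r _ 2)// ?nnegrE ?normc_ge0// sqr_normcE real_normK ?num_real//.
by rewrite lerDr sqr_ge0.
Qed.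

Lemma ler_normcReIm z : normc z <= `|complex.Re z| + `|complex.Im z|.
Proof.
rewrite -(@ler_pXn2r _ 2)// ?nnegrE ?normc_ge0 ?addr_ge0// sqr_normcE sqrrD.
by rewrite !real_normK ?num_real// addrAC lerDl mulrn_wge0// mulr_ge0.
Qed.

End ComplexModulus.

Section SlitPlane.
Variable R : realType.
Implicit Types (x : R) (t : R[i]).

(** The complement of ]-oo, 0], since the order of [R[i]] compares only numbers with equal imaginary
    parts. It is the mirror image of the domain of the Stieltjes transform, because the zeros are
    written as - x. *)
Definition slit t := ~~ (t <= 0).

(** For [t = r e^(i phi)] the quantity is [r (1 + cos phi)]; the lower bounds below are expressed
    through it. *)
Lemma slit_gt0 t : slit t -> 0 < normc t + complex.Re t.
Proof.
apply: contraR; rewrite -leNgt => h; rewrite lecE/=.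
have := sqr_normcE t; have := normc_ge0 t; move: h.
move: (normc t) (complex.Re t) (complex.Im t) => r a b h r0 e.
have b0 : b ^+ 2 <= 0 by nra.
have -> : b = 0 by apply/eqP; rewrite -sqrf_eq0 eq_le b0 sqr_ge0.
by rewrite eqxx; lra.
Qed.

Lemma slit_neq0 t : slit t -> t != 0.
Proof. by apply: contraNneq => ->. Qed.

Lemma slit_normc_gt0 t : slit t -> 0 < normc t.
Proof. by rewrite normc_gt0; exact: slit_neq0. Qed.

Lemma slit_addR_neq0 t x : 0 <= x -> slit t -> t + x%:C != 0.
Proof.
move=> x0; apply: contraNneq => /eqP; rewrite addr_eq0 => /eqP ->.
by rewrite oppr_le0 ler0c.
Qed.

(* With t = r e^(i phi), |t + x|^2 - (r + x)^2 (1 + cos phi) / 2 =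
   (r - x)^2 (1 - cos phi) / 2. *)
Lemma slit_normcD_ge t : slit t ->
  exists2 kappa : R, 0 < kappa & forall x, 0 <= x -> kappa * (1 + x) <= normc (t + x%:C).
Proof.
move=> st; have r0 := slit_normc_gt0 st; have k0 := slit_gt0 st.
have := sqr_normcE t; have := ler_normRe t; move: r0 k0.
set r := normc t; set a := complex.Re t => r0 k0 ar e.
(* [m = min(r, 1)] serves to replace [r + x] by [1 + x]. *)
have [m [m0 m1 mr]] : exists m : R, [/\ 0 < m, m <= 1 & m <= r].
  by exists (Num.min r 1); rewrite lt_min r0 ltr01 !ge_min !lexx orbT.
exists (m * ((r + a) / (2 * r))).
  by rewrite mulr_gt0// divr_gt0// mulr_gt0.
move=> x x0; set c := (r + a) / (2 * r).
have c0 : 0 < c by rewrite divr_gt0// mulr_gt0.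
have ar' : a <= r by rewrite (le_trans (ler_norm _)).
(* As [c <= 1], the number [c] may replace its square root in the bound drawn from
   [|t + x|^2 >= c (r + x)^2]. *)
have c1 : c <= 1 by rewrite ler_pdivrMr ?mulr_gt0// mul1r; lra.
have ac : a = (2 * c - 1) * r by rewrite /c; field; rewrite gt_eqF.
apply: (@le_trans _ _ (c * (r + x))).
  rewrite (_ : m * c * (1 + x) = c * (m * (1 + x))); last by ring.
  rewrite ler_pM2l//.
  have mx : m * x <= 1 * x by rewrite ler_wpM2r.
  by lra.
rewrite -(@ler_pXn2r _ 2)// ?nnegrE ?normc_ge0//; last first.
  by rewrite mulr_ge0 ?addr_ge0// ltW.
rewrite sqr_normcE !raddfD/= addr0 -/a.
have -> : (a + x) ^+ 2 + complex.Im t ^+ 2 = r ^+ 2 + 2 * a * x + x ^+ 2.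
  by rewrite e -/a; ring.
rewrite exprMn ac.
have : 0 <= (1 - c) * (r - x) ^+ 2 by rewrite mulr_ge0 ?sqr_ge0// subr_ge0.
have : 0 <= c * (1 - c) * (r + x) ^+ 2.
  by rewrite mulr_ge0 ?sqr_ge0// mulr_ge0 ?subr_ge0// ltW.
by lra.
Qed.

(* All the numbers (1 + x) / (t + x), and 1, lie in the half-plane
   Re ((|t| + t) z) > 0. *)
Lemma slit_halfplane t x : slit t -> 0 <= x ->
  (normc t + complex.Re t) / (1 + normc t) <=
  complex.Re (((normc t)%:C + t) * ((1 + x)%:C / (t + x%:C))).
Proof.
case: t => a b st x0; have r0 := slit_normc_gt0 st; have k0 := slit_gt0 st.
have tx0 := slit_addR_neq0 x0 st.
have e := sqr_normcE (a +i* b); have ntx := ler_normcD (a +i* b) x%:C.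
rewrite normcR ger0_norm// in ntx.
have N0 : 0 < normc ((a +i* b) + x%:C) by rewrite normc_gt0.
have eN := sqr_normcE ((a +i* b) + x%:C).
move: (normc (a +i* b + x%:C)) (normc (a +i* b)) => N r in r0 k0 e ntx N0 eN *.
have -> : complex.Re ((r%:C + (a +i* b)) * ((1 + x)%:C / (a +i* b + x%:C))) =
    (1 + x) * ((r + a) * (r + x)) / N ^+ 2.
  have N20 : N ^+ 2 != 0 by rewrite sqrf_eq0 gt_eqF.
  rewrite eN/= in N20 *; rewrite !addr0 in N20 *.
  have eb : b ^+ 2 = r ^+ 2 - a ^+ 2 by rewrite e/=; ring.
  rewrite !mul0r !subr0 !add0r; rewrite eb in N20 *.
  rewrite [LHS](_ : _ = (1 + x) * ((r + a) * (a + x) + b ^+ 2)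
    / ((a + x) ^+ 2 + (r ^+ 2 - a ^+ 2))); last by ring.
  by congr (_ / _); rewrite eb; ring.
rewrite /= in k0 *.
rewrite ler_pdivrMr ?addr_gt0// mulrAC ler_pdivlMr ?exprn_gt0//.
(* With [|t + x| <= r + x] the claim reduces to [r + x <= (1 + x) (1 + r)]. *)
have N2 : N ^+ 2 <= (r + x) ^+ 2 by apply: lerXn2r => //; rewrite nnegrE ?addr_ge0// ltW.
have -> : (1 + x) * ((r + a) * (r + x)) * (1 + r) =
    (r + a) * ((1 + x) * (1 + r) * (r + x)) by ring.
rewrite ler_pM2l// (le_trans N2)// expr2 ler_pM2r; last by lra.
by have := mulr_ge0 x0 (ltW r0); lra.
Qed.

End SlitPlane.

(** * Logarithmic derivatives of polynomials given by their zeros *)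

Section RootSums.
Variable F : fieldType.
Implicit Types (s : seq F) (t c : F).

Definition roots_poly c s : {poly F} := c *: \prod_(x <- s) ('X + x%:P).

Lemma horner_roots_poly_neq0 c s t : c != 0 -> (forall x, x \in s -> t + x != 0) ->
  (roots_poly c s).[t] != 0.
Proof.
move=> c0 st; rewrite /roots_poly hornerZ horner_prod mulf_neq0//.
rewrite prodf_seq_neq0; apply/allP => x xs; rewrite !hornerE.
exact: st.
Qed.

Lemma roots_polyS c x s : roots_poly c (x :: s) = ('X + x%:P) * roots_poly c s.
Proof. by rewrite /roots_poly big_cons scalerAr. Qed.

Lemma horner_deriv_roots_poly c s t : (forall x, x \in s -> t + x != 0) ->
  (roots_poly c s)^`().[t] = (roots_poly c s).[t] * \sum_(x <- s) (t + x)^-1.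
Proof.
elim: s => [|x s IH] st.
  by rewrite /roots_poly !big_nil derivZ -polyC1 derivC scaler0 horner0 mulr0.
rewrite roots_polyS derivM derivD derivX derivC addr0 mul1r !(hornerM, hornerD, hornerX, hornerC).
rewrite IH => [|y ys]; last by rewrite st// in_cons ys orbT.
rewrite big_cons; have tx := st x (mem_head x s).
by field.
Qed.

(** This is [p'' / p = (p' / p)^2 + (p' / p)']. *)
Lemma horner_deriv2_roots_poly c s t : (forall x, x \in s -> t + x != 0) ->
  (roots_poly c s)^`()^`().[t] = (roots_poly c s).[t] *
    ((\sum_(x <- s) (t + x)^-1) ^+ 2 - \sum_(x <- s) (t + x)^-1 ^+ 2).
Proof.
elim: s => [|x s IH] st.
  by rewrite /roots_poly !big_nil derivZ -polyC1 derivC scaler0 deriv0 horner0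
    expr0n subr0 mulr0.
have st' y : y \in s -> t + y != 0 by move=> ys; rewrite st// in_cons ys orbT.
rewrite roots_polyS derivM derivD derivX derivC addr0 mul1r derivD derivM.
rewrite derivD derivX derivC addr0 mul1r !(hornerM, hornerD, hornerX, hornerC).
rewrite IH// horner_deriv_roots_poly// !big_cons; have tx := st x (mem_head x s).
by field.
Qed.

End RootSums.

(** * Real-rootedness and ratios *)

Section RealRooted.
Variable R : realType.
Implicit Types (theta x : R) (t z : R[i]) (s : seq R).

Lemma roots_poly_nonpos (p : {poly R[i]}) (r : seq R[i]) :
  p = lead_coef p *: \prod_(z <- r) ('X - z%:P) -> p != 0 ->
  (forall z, root p z -> z <= 0) ->
  all (>= 0) [seq - complex.Re z | z <- r] /\
  p = roots_poly (lead_coef p) [seq x%:C | x <- [seq - complex.Re z | z <- r]].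
Proof.
move=> pE p0 pr.
have rle z : z \in r -> z <= 0.
  move=> zr; apply: pr; rewrite pE rootZ ?lead_coef_eq0// root_prod_XsubC//.
split; first by apply/allP => _ /mapP[z /rle + ->]; rewrite lecE oppr_ge0 => /andP[].
rewrite {1}pE /roots_poly -map_comp big_map; congr (_ *: _).
apply: eq_big_seq => z /rle; rewrite lecE => /andP[/eqP z0 _].
congr (_ + _); rewrite -polyCN; congr (_%:P).
by case: z z0 => a b /= <-; apply/eqP; rewrite eq_complex /= oppr0 !eqxx.
Qed.

Definition sratio theta (n : nat) t : R[i] :=
  (sibuya_poly theta%:C n.+1).[t] / (theta%:C * (sibuya_poly theta%:C n).[t]).

Lemma sratioE theta n t c s : slit t -> 0 < theta -> c != 0 -> all (>= 0) s ->
  sibuya_poly theta%:C n = roots_poly c [seq x%:C | x <- s] ->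
  sratio theta n t =
  t * (1 + (1 - t) / theta%:C * \sum_(x <- s) (t + x%:C)^-1).
Proof.
move=> st th0 c0 /allP s0 e.
have ts z : z \in [seq x%:C | x <- s] -> t + z != 0.
  by move=> /mapP[y /s0 y0 ->]; exact: slit_addR_neq0.
have pt0 := horner_roots_poly_neq0 c0 ts.
rewrite /sratio horner_sibuya_polyS e horner_deriv_roots_poly// big_map.
have th0' : theta%:C != 0 by rewrite fmorph_eq0 gt_eqF.
by field; apply/andP.
Qed.

(** By [(1 + x) / (t + x) = 1 + (1 - t) / (t + x)]. For [n <= theta] the right-hand side is [t]
    times a convex combination of 1 and the numbers [(1 + x) / (t + x)], the form to which
    [slit_halfplane] applies. *)
Lemma sratioE_halfplane theta n t s : slit t -> 0 < theta -> all (>= 0) s ->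
  size s = n ->
  t * (1 + (1 - t) / theta%:C * \sum_(x <- s) (t + x%:C)^-1) =
  t / theta%:C * ((theta - n%:R)%:C + \sum_(x <- s) (1 + x)%:C / (t + x%:C)).
Proof.
move=> st th0 /allP s0 sn.
have th0' : theta%:C != 0 by rewrite fmorph_eq0 gt_eqF.
have -> : \sum_(x <- s) (1 + x)%:C / (t + x%:C) =
    n%:R + (1 - t) * \sum_(x <- s) (t + x%:C)^-1.
  rewrite mulr_sumr -sn -sum1_size natr_sum -big_split/=.
  apply: eq_big_seq => x /s0 x0; have tx := slit_addR_neq0 x0 st.
  by rewrite rmorphD rmorph1; field.
by rewrite rmorphB rmorph_nat; field.
Qed.

(** Half the bound of [slit_halfplane]: the factor 1/2 comes from [||t| + t| <= 2 |t|], and the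
    remaining |t| cancels against the factor [t] of the ratio. *)
Definition sratio_bound t : R :=
  (normc t + complex.Re t) / (1 + normc t) / 2.

Lemma sratio_bound_gt0 t : slit t -> 0 < sratio_bound t.
Proof.
move=> st; have := slit_gt0 st; have := slit_normc_gt0 st => t0 k0.
by rewrite !divr_gt0// addr_gt0.
Qed.

Lemma sratio_normc_ge theta n t c s : slit t -> 0 < theta -> n%:R <= theta -> c != 0 ->
  all (>= 0) s -> size s = n ->
  sibuya_poly theta%:C n = roots_poly c [seq x%:C | x <- s] ->
  sratio_bound t <= normc (sratio theta n t).
Proof.
move=> st th0 nth c0 s0 sn e; rewrite (sratioE st th0 c0 s0 e).
rewrite (sratioE_halfplane st th0 s0 sn).
have t0 := slit_normc_gt0 st; have k0 := slit_gt0 st.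
set b := (_ + \sum_(x <- s) _); set k := (normc t + complex.Re t) / (1 + normc t).
(* The point 1, which carries the weight [theta - n], lies in the half-plane with the same margin
   [k]. *)
have kk : k <= normc t + complex.Re t.
  by rewrite ler_pdivrMr ?addr_gt0//; have := mulr_gt0 k0 t0; lra.
have k0' : 0 < k by rewrite divr_gt0// addr_gt0.
have Reb : theta * k <= complex.Re (((normc t)%:C + t) * b).
  rewrite mulrDr raddfD/= mulr_sumr raddf_sum/=.
  have -> : complex.Re (((normc t)%:C + t) * (theta - n%:R)%:C) =
      (theta - n%:R) * (normc t + complex.Re t).
    by case: (t) => x y /=; rewrite mulr0 subr0 mulrC.
  have -> : theta * k = (theta - n%:R) * k + n%:R * k by ring.
  apply: lerD; first by rewrite ler_wpM2l ?subr_ge0.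
  rewrite -sn -sum1_size natr_sum mulr_suml big_seq [leRHS]big_seq.
  apply: ler_sum => x xs; rewrite mul1r; apply: slit_halfplane => //.
  exact: (allP s0).
have bE : theta * k <= (2 * normc t) * normc b.
  apply: (le_trans Reb); apply: (le_trans (ler_norm _)).
  apply: (le_trans (ler_normRe _)); rewrite Normc.normcM ler_wpM2r ?normc_ge0//.
  by rewrite (le_trans (ler_normcD _ _))// normcR ger0_norm ?normc_ge0// -mulr2n mulr_natl.
rewrite !Normc.normcM Normc.normcV normcR gtr0_norm// -/k mulrAC ler_pdivlMr//.
rewrite /sratio_bound -/k mulrAC ler_pdivrMr//; lra.
Qed.

Lemma sibuya_poly_roots theta n : n%:R <= theta ->
  exists c s, [/\ c != 0, all (>= 0) s, size s = n &
    sibuya_poly theta%:C n = roots_poly c [seq x%:C | x <- s]].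
Proof.
elim: n => [|n IH] nth.
  by exists 1, [::]; split => //; rewrite ?oner_eq0// /roots_poly big_nil scale1r.
have nth' : n%:R < theta by rewrite (lt_le_trans _ nth)// ltr_nat.
have th0 : 0 < theta by rewrite (le_lt_trans _ nth').
have [c [s [c0 s0 sn e]]] := IH (ltW nth').
have sz : size (sibuya_poly theta%:C n.+1) = n.+2.
  apply: size_sibuya_poly => j jn; apply/eqP => thj.
  have : theta = j%:R by apply: (@complexI R); rewrite thj rmorph_nat.
  by move=> E; move: nth; rewrite E ler_nat leqNgt jn.
have p0 : sibuya_poly theta%:C n.+1 != 0 by rewrite -size_poly_eq0 sz.
have [r rE] := closed_field_poly_normal (sibuya_poly theta%:C n.+1).
have rn : size r = n.+1.
  apply: eq_add_S; rewrite -sz rE size_scale ?lead_coef_eq0//.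
  by rewrite size_prod_XsubC.
have [|r0 e'] := roots_poly_nonpos rE p0.
  move=> z; apply: contraLR => sz'.
  have := sratio_normc_ge sz' th0 (ltW nth') c0 s0 sn e; apply: contraL => /rootP z0.
  by rewrite /sratio z0 mul0r Normc.normc0 -ltNge sratio_bound_gt0.
by exists (lead_coef (sibuya_poly theta%:C n.+1)), [seq - complex.Re z | z <- r];
  rewrite lead_coef_eq0 size_map.
Qed.

Lemma sratio_ge theta n t : slit t -> 0 < theta -> n%:R <= theta ->
  sratio_bound t <= normc (sratio theta n t).
Proof.
move=> st th0 nth; have [c [s [c0 s0 sn e]]] := sibuya_poly_roots nth.
exact: sratio_normc_ge e.
Qed.

Lemma sibuya_poly_neq0 theta n t : slit t -> n%:R <= theta ->
  (sibuya_poly theta%:C n).[t] != 0.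
Proof.
move=> st nth; have [c [s [c0 s0 sn ->]]] := sibuya_poly_roots nth.
apply: horner_roots_poly_neq0 => // z /mapP[x xs ->].
by apply: slit_addR_neq0 => //; exact: (allP s0).
Qed.

Lemma normc_root_sum_le t (kappa : R) s k : 0 < kappa -> all (>= 0) s ->
  (forall x, 0 <= x -> kappa * (1 + x) <= normc (t + x%:C)) ->
  normc (\sum_(x <- s) (t + x%:C)^-1 ^+ k) <= (size s)%:R * kappa^-1 ^+ k.
Proof.
move=> k0 /allP s0 kt; apply: (le_trans (ler_normc_sum _ _ _)).
rewrite -sum1_size natr_sum mulr_suml big_seq [leRHS]big_seq; apply: ler_sum => x /s0 x0.
rewrite mul1r normcX Normc.normcV; apply: lerXn2r; rewrite ?nnegrE ?invr_ge0 ?normc_ge0//.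
  exact: ltW.
have h : kappa <= normc (t + x%:C).
  by apply: le_trans (kt _ x0); rewrite ler_peMr ?lerDl// ltW.
by rewrite lef_pV2// posrE (lt_le_trans k0).
Qed.

(** Write Q_n for the polynomials and r_n for the ratios. Since [Q_(n+1) = theta Q_n r_n], passing
    from n to n + 1 adds [r_n' / r_n] to the logarithmic derivative, so [r_(n+1) - r_n = t (1 - t) /
    theta * r_n' / r_n]. Here r_n' is bounded because the sums of [1 / (t + x)] and of
    [1 / (t + x)^2] have at most [theta] bounded terms, and r_n is bounded away from 0. *)
Lemma sratio_diff t : slit t ->
  exists2 C : R, 0 <= C & forall theta n, 0 < theta -> n.+1%:R <= theta ->
    normc (sratio theta n.+1 t - sratio theta n t) <= C / theta.
Proof.
move=> st; have [kappa k0 kt] := slit_normcD_ge st; have b0 := sratio_bound_gt0 st.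
pose C := normc (t * (1 - t)) *
  (1 + normc (1 - t *+ 2) * kappa^-1 + normc (t * (1 - t)) * kappa^-1 ^+ 2).
have C0 : 0 <= C by rewrite !(mulr_ge0, addr_ge0) ?exprn_ge0 ?invr_ge0 ?normc_ge0 ?(ltW k0).
exists (C / sratio_bound t) => [|theta n th0 nth]; first by rewrite divr_ge0// ltW.
have nth' : n%:R <= theta by rewrite (le_trans _ nth)// ler_nat.
have [c [s [c0 s0 sn e]]] := sibuya_poly_roots nth'.
have rb := sratio_ge st th0 nth'; have rE := sratioE st th0 c0 s0 e.
have q1 := sibuya_poly_neq0 st nth; have q0 := sibuya_poly_neq0 st nth'.
have th : theta%:C != 0 by rewrite fmorph_eq0 gt_eqF.
have r0 : sratio theta n t != 0 by rewrite -normc_gt0 (lt_le_trans b0).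
have L1 : normc (\sum_(x <- s) (t + x%:C)^-1) <= (size s)%:R * kappa^-1.
  exact: (normc_root_sum_le 1 k0 s0 kt).
have L2 := normc_root_sum_le 2 k0 s0 kt; rewrite -> sn in L1, L2.
have ts z : z \in [seq x%:C | x <- s] -> t + z != 0.
  by move=> /mapP[x xs ->]; apply: slit_addR_neq0 => //; exact: (allP s0).
have e1 := horner_deriv_roots_poly c ts; have e2 := horner_deriv2_roots_poly c ts.
rewrite -e !big_map in e1 e2.
have -> : sratio theta n.+1 t - sratio theta n t = t * (1 - t) / theta%:C *
   (1 + (1 - t *+ 2) * (\sum_(x <- s) (t + x%:C)^-1) / theta%:C
    - t * (1 - t) * (\sum_(x <- s) (t + x%:C)^-1 ^+ 2) / theta%:C) / sratio theta n t.
  have q1E : (sibuya_poly theta%:C n.+1).[t] =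
      theta%:C * (sibuya_poly theta%:C n).[t] * sratio theta n t.
    by rewrite /sratio; field; rewrite q0.
  rewrite {1}/sratio horner_sibuya_polyS horner_deriv_sibuya_polyS e1 e2 q1E.
  move: (sratio theta n t) (\sum_(x <- s) _) (\sum_(x <- s) _) _.[t] rE r0 q0.
  move=> r S2 S q rE r0 q0.
  have D0 : theta%:C + (1 - t) * S != 0.
    apply: contraNneq r0 => D0; rewrite rE.
    have -> : t * (1 + (1 - t) / theta%:C * S) =
        t / theta%:C * (theta%:C + (1 - t) * S) by field.
    by rewrite D0 mulr0.
  by rewrite rE; field; rewrite th q0 D0 slit_neq0.
rewrite Normc.normcM Normc.normcV Normc.normcM (Normc.normcM _ theta%:C^-1) Normc.normcV.
rewrite normcR gtr0_norm// (mulrAC (normc (t * (1 - t)))) [leLHS]mulrAC.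
rewrite ler_pM2r ?invr_gt0//; apply: ler_pM.
- by rewrite mulr_ge0 ?normc_ge0.
- by rewrite invr_ge0 normc_ge0.
- rewrite /C; apply: ler_wpM2l; first exact: normc_ge0.
  rewrite (le_trans (ler_normcB _ _))//; apply: lerD.
    rewrite (le_trans (ler_normcD _ _))// Normc.normc1 lerD2l.
    rewrite !Normc.normcM Normc.normcV normcR gtr0_norm// -mulrA.
    apply: ler_wpM2l; first exact: normc_ge0.
    rewrite ler_pdivrMr// (le_trans L1)// mulrC; apply: ler_wpM2l => //.
    by rewrite invr_ge0 ltW.
  rewrite Normc.normcM Normc.normcM Normc.normcV normcR gtr0_norm// -mulrA.
  apply: ler_wpM2l; first exact: normc_ge0.
  rewrite ler_pdivrMr// (le_trans L2)// mulrC; apply: ler_wpM2l => //.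
  by rewrite exprn_ge0// invr_ge0 ltW.
- by rewrite lef_pV2// posrE (lt_le_trans b0).
Qed.

End RealRooted.

(** * The equation for the ratios up to an error O(1 / theta) *)

Section RatioEquation.
Variable R : realType.
Implicit Types (theta x : R) (t z : R[i]) (s : seq R).

Lemma sratio_le t : slit t ->
  exists M : R, forall theta n, 0 < theta -> n%:R <= theta -> normc (sratio theta n t) <= M.
Proof.
move=> st; have [kappa k0 kt] := slit_normcD_ge st.
exists (normc t * (1 + normc (1 - t) / kappa)) => theta n th0 nth.
have [c [s [c0 s0 sn e]]] := sibuya_poly_roots nth.
rewrite (sratioE st th0 c0 s0 e) Normc.normcM; apply: ler_wpM2l; first exact: normc_ge0.
rewrite (le_trans (ler_normcD _ _))// Normc.normc1 lerD2l.
rewrite !Normc.normcM Normc.normcV normcR gtr0_norm// -mulrA.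
apply: ler_wpM2l; first exact: normc_ge0.
rewrite mulrC ler_pdivrMr// (le_trans (normc_root_sum_le 1 k0 s0 kt))// sn mulrC.
by apply: ler_wpM2l => //; rewrite invr_ge0 ltW.
Qed.

Lemma sratio_diff_iter t : slit t ->
  exists2 C : R, 0 <= C & forall theta n i, 0 < theta -> n%:R <= theta -> (i <= n)%N ->
    normc (sratio theta (n - i) t - sratio theta n t) <= i%:R * (C / theta).
Proof.
move=> st; have [C C0 Cd] := sratio_diff st; exists C => // theta n i th0 nth.
elim: i => [|i IH] ni; first by rewrite subn0 subrr Normc.normc0 mul0r.
rewrite -(subrKA (sratio theta (n - i) t)) (le_trans (ler_normcD _ _))//.
rewrite -natr1 mulrDl mul1r addrC; apply: lerD; first by rewrite IH// ltnW.
rewrite normcBC -{1}(subnSK ni); apply: Cd => //; rewrite subnSK//.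
by rewrite (le_trans _ nth)// ler_nat leq_subr.
Qed.

(** [A] is the product of the inverses of the i ratios just below index n. With K the inverse of
    [sratio_bound t], replacing the j-th of them by the inverse of the n-th ratio costs at most
    [K^2 j C / theta], the other factors are at most K, and summation over j gives at most [i^2]. *)
Lemma sibuya_poly_quot_le t : slit t ->
  exists2 C : R, 0 <= C & forall theta n i, 0 < theta -> n%:R <= theta -> (i <= n)%N ->
    let A := theta%:C ^+ i * (sibuya_poly theta%:C (n - i)).[t] /
              (sibuya_poly theta%:C n).[t] in
    normc A <= (sratio_bound t)^-1 ^+ i /\
    normc (A - (sratio theta n t)^-1 ^+ i) <=
      (sratio_bound t)^-1 ^+ i.+1 * i%:R ^+ 2 * (C / theta).
Proof.
move=> st; have [C C0 Cd] := sratio_diff_iter st; exists C => // theta n i th0 nth.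
have b0 := sratio_bound_gt0 st; set K := (sratio_bound t)^-1.
have K0 : 0 < K by rewrite invr_gt0.
have th : theta%:C != 0 by rewrite fmorph_eq0 gt_eqF.
have rK m : (m <= n)%N -> normc (sratio theta m t)^-1 <= K.
  move=> mn; rewrite Normc.normcV lef_pV2 ?posrE//.
    by apply: sratio_ge => //; rewrite (le_trans _ nth)// ler_nat.
  by rewrite (lt_le_trans b0)// sratio_ge// (le_trans _ nth)// ler_nat.
have r0 m : (m <= n)%N -> sratio theta m t != 0.
  move=> mn; rewrite -normc_gt0 (lt_le_trans b0)// sratio_ge//.
  by rewrite (le_trans _ nth)// ler_nat.
have q0 m : (m <= n)%N -> (sibuya_poly theta%:C m).[t] != 0.
  by move=> mn; rewrite sibuya_poly_neq0// (le_trans _ nth)// ler_nat.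
elim: i => [|i IH] ni A.
  rewrite /A subn0 !expr0 mul1r divff ?q0// subrr Normc.normc0 Normc.normc1 lexx.
  by rewrite expr0n/= mulr0 mul0r.
have [A1 A2] := IH (ltnW ni); set B := _ / _ in A1 A2.
set r := sratio theta n t in A2 *; pose r' := sratio theta (n - i.+1) t.
have AE : A = B / r'.
  have r'0 : r' != 0 by rewrite r0// leq_subr.
  rewrite /A /B -(subnSK ni).
  have -> : (sibuya_poly theta%:C (n - i.+1).+1).[t] =
      theta%:C * (sibuya_poly theta%:C (n - i.+1)).[t] * r'.
    rewrite /r' /sratio; field; rewrite q0 ?leq_subr//.
  by rewrite exprS; field; rewrite r'0 q0.
have r'K : normc r'^-1 <= K by rewrite rK// leq_subr.
split.
  rewrite AE Normc.normcM exprSr; apply: ler_pM; rewrite ?normc_ge0//.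
have -> : A - r^-1 ^+ i.+1 = (B - r^-1 ^+ i) / r' + r^-1 ^+ i * (r'^-1 - r^-1).
  by rewrite AE exprSr; ring.
have rr' : normc (r'^-1 - r^-1) <= K ^+ 2 * (i.+1%:R * (C / theta)).
  have -> : r'^-1 - r^-1 = r'^-1 * r^-1 * (r - r').
    by field; rewrite !r0// leq_subr.
  rewrite !Normc.normcM normcBC; apply: ler_pM; rewrite ?mulr_ge0 ?normc_ge0//.
    by rewrite expr2; apply: ler_pM; rewrite ?normc_ge0// rK.
  exact: Cd.
rewrite (le_trans (ler_normcD _ _))// !Normc.normcM normcX.
have h1 : normc (B - r^-1 ^+ i) * normc r'^-1 <= K ^+ i.+1 * i%:R ^+ 2 * (C / theta) * K.
  by apply: ler_pM; rewrite ?normc_ge0.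
have h2 : normc r^-1 ^+ i * normc (r'^-1 - r^-1) <= K ^+ i * (K ^+ 2 * (i.+1%:R * (C / theta))).
  apply: ler_pM; rewrite ?exprn_ge0 ?normc_ge0//.
  by apply: lerXn2r; rewrite ?nnegrE ?normc_ge0 ?rK// ltW.
rewrite (le_trans (lerD h1 h2))// -natr1 !exprS.
set a := C / theta; have a0 : 0 <= a by rewrite divr_ge0// ltW.
have -> : K * (K * K ^+ i) * ((i%:R + 1) * ((i%:R + 1) * (i%:R + 1) ^+ 0)) * a =
  K * K ^+ i * (i%:R * (i%:R * i%:R ^+ 0)) * a * K + K ^+ i * (K * (K * K ^+ 0) * ((i%:R + 1) * a))
   + K * K * K ^+ i * i%:R * a by rewrite !expr0; ring.
by rewrite lerDl !mulr_ge0 ?exprn_ge0 ?(ltW K0) ?invr_ge0 ?(ltW th0)//.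
Qed.

(** Dividing the convolution identity by [theta Q_n] gives the coefficients [A i * (1 - r_(n-i))];
    with [r^-i (1 - r)] in their place the sum is an exact binomial expansion. *)
Lemma sratio_equation t : slit t ->
  exists C : R, forall theta n, 0 < theta -> n%:R <= theta ->
    let r := sratio theta n t in
    normc ((1 - t) * r - t * (1 + (theta%:C * r)^-1) ^+ n * (1 - r)) <= C / theta.
Proof.
move=> st; have [C C0 Cd] := sratio_diff_iter st.
have [C' C'0 Cq] := sibuya_poly_quot_le st; have [M rM] := sratio_le st.
have b0 := sratio_bound_gt0 st; pose K := (sratio_bound t)^-1.
have K0 : 0 < K by rewrite invr_gt0.
pose D := K * C' * (1 + M) + C.
(* [D / theta] bounds the error in the i-th coefficient once [K^i] and [i^2 <= 4^i] are split off;
   the sum is then [(1 + 4 K / theta)^n], at most [e^(4 K)] as [n <= theta]. *)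
exists (normc t * D * expR (4 * K)) => theta n th0 nth /=; set r := sratio theta n t.
have th : theta%:C != 0 by rewrite fmorph_eq0 gt_eqF.
have q0 m : (m <= n)%N -> (sibuya_poly theta%:C m).[t] != 0.
  by move=> mn; rewrite sibuya_poly_neq0// (le_trans _ nth)// ler_nat.
have r0 : r != 0 by rewrite -normc_gt0 (lt_le_trans b0)// sratio_ge.
have rnM : normc (1 - r) <= 1 + M.
  by rewrite (le_trans (ler_normcB _ _))// Normc.normc1 lerD2l rM.
have D0 : 0 <= D.
  by rewrite addr_ge0// !mulr_ge0 ?(ltW K0)// (le_trans _ rnM)// normc_ge0.
pose A i := theta%:C ^+ i * (sibuya_poly theta%:C (n - i)).[t] /
              (sibuya_poly theta%:C n).[t].
have conv : (1 - t) * r = t * \sum_(i < n.+1)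
    'C(n, i)%:R * theta%:C ^- i * (A i * (1 - sratio theta (n - i) t)).
  have := congr1 (fun p => p.[t] / (theta%:C * (sibuya_poly theta%:C n).[t]))
    (sibuya_poly_convolution theta%:C n).
  rewrite hornerM [X in _ = X / _]hornerM hornerX.
  have -> : (1 - 'X : {poly R[i]}).[t] = 1 - t by rewrite !hornerE.
  rewrite -mulrA -/(sratio theta n t) => ->.
  rewrite -mulrA; congr (_ * _).
  (* The sum is reversed, [j = n - i], so that [i] counts the steps down from [n]. *)
  rewrite horner_sum mulr_suml (reindex_inj rev_ord_inj)/=; apply: eq_bigr => i _.
  rewrite subSS hornerZ hornerD hornerN hornerZ bin_sub -1?ltnS//.
  by rewrite /A /sratio; field; rewrite ?th ?expf_neq0 ?q0 ?leq_subr ?ltnS ?leq_ord.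
have bino : (1 + (theta%:C * r)^-1) ^+ n * (1 - r) = \sum_(i < n.+1)
    'C(n, i)%:R * theta%:C ^- i * (r^-1 ^+ i * (1 - r)).
  rewrite exprDn mulr_suml; apply: eq_bigr => i _.
  by rewrite expr1n mul1r invfM exprMn -mulr_natl !exprVn; ring.
rewrite conv -mulrA bino -mulrBr Normc.normcM -sumrB -!mulrA ler_wpM2l ?normc_ge0//.
rewrite (le_trans (ler_normc_sum _ _ _))//.
apply: (@le_trans _ _ (\sum_(i < n.+1) 'C(n, i)%:R * theta^-1 ^+ i * ((4 * K) ^+ i * (D / theta)))).
  apply: ler_sum => i _; rewrite -mulrBr Normc.normcM.
  have -> : normc ('C(n, i)%:R * theta%:C ^- i) = 'C(n, i)%:R * theta^-1 ^+ i.
    rewrite Normc.normcM Normc.normcV normcX normcR gtr0_norm// exprVn.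
    by rewrite -(rmorph_nat (real_complex R)) normcR ger0_norm.
  rewrite ler_wpM2l ?mulr_ge0 ?exprn_ge0 ?invr_ge0 ?(ltW th0)//.
  have ni : (i <= n)%N by rewrite -ltnS.
  have [A1 A2] := Cq theta n i th0 nth ni; rewrite -/(A i) -/r -/K in A1 A2.
  have A3 := Cd theta n i th0 nth ni; rewrite -/r in A3.
  have -> : A i * (1 - sratio theta (n - i) t) - r^-1 ^+ i * (1 - r) =
     (A i - r^-1 ^+ i) * (1 - r) - A i * (sratio theta (n - i) t - r) by ring.
  rewrite (le_trans (ler_normcB _ _))// (Normc.normcM (A i - _)) (Normc.normcM (A i)).
  have h1 := ler_pM (normc_ge0 _) (normc_ge0 _) A2 rnM.
  have h2 := ler_pM (normc_ge0 _) (normc_ge0 _) A1 A3.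
  rewrite (le_trans (lerD h1 h2))//.
  have i2 : i%:R <= i%:R ^+ 2 :> R by rewrite -natrX ler_nat; case: (nat_of_ord i) => // j; rewrite leq_pmulr.
  have i4 : i%:R ^+ 2 <= 4 ^+ i :> R.
    rewrite -!natrX ler_nat (_ : 4 = 2 ^ 2)%N// -expnM mulnC expnM leq_exp2r//.
    by rewrite ltnW// ltn_expl.
  have Ki : 0 <= K ^+ i by rewrite exprn_ge0// ltW.
  have iTh : 0 <= theta^-1 by rewrite invr_ge0 ltW.
  have M0 : 0 <= 1 + M by rewrite (le_trans _ rnM)// normc_ge0.
  rewrite exprMn [leLHS](_ : _ = K ^+ i * (theta^-1 * (K * C' * (1 + M) * i%:R ^+ 2 + C * i%:R))).
    rewrite [leRHS](_ : _ = K ^+ i * (theta^-1 * (4 ^+ i * D))); last by ring.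
    rewrite !ler_wpM2l// /D [leRHS]mulrDr; apply: lerD; rewrite [leRHS]mulrC ler_wpM2l//.
      by rewrite !mulr_ge0// ltW.
    exact: le_trans i4.
  by rewrite exprS; ring.
have -> : \sum_(i < n.+1) 'C(n, i)%:R * theta^-1 ^+ i * ((4 * K) ^+ i * (D / theta)) =
    (1 + 4 * K / theta) ^+ n * (D / theta).
  rewrite exprDn mulr_suml; apply: eq_bigr => i _.
  by rewrite expr1n mul1r !exprMn -mulr_natl; ring.
rewrite [leRHS](_ : _ = expR (4 * K) * (D / theta)); last by ring.
rewrite ler_wpM2r ?divr_ge0 ?(ltW th0)//.
apply: (@le_trans _ _ (expR (4 * K / theta) ^+ n)).
  apply: lerXn2r; rewrite ?nnegrE ?expR_ge0 ?expR_ge1Dx//.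
  by rewrite addr_ge0// divr_ge0 ?mulr_ge0 ?(ltW K0)// ltW.
rewrite -expRM_natl ler_expR mulrCA ler_piMr ?mulr_ge0 ?(ltW K0)//.
by rewrite ler_pdivrMr// mul1r.
Qed.

End RatioEquation.

(** * The complex exponential *)

Section ComplexExp.
Variable R : realType.
Implicit Types (a b x : R) (h u v z w : R[i]).

Lemma cexpD u v : cexp (u + v) = cexp u * cexp v.
Proof.
case: u => a b; case: v => c d; rewrite /cexp /= expRD cosD sinD.
by apply/eqP; rewrite eq_complex /=; apply/andP; split; apply/eqP; ring.
Qed.

Lemma cexpR x : cexp x%:C = (expR x)%:C.
Proof. by rewrite /cexp /= cos0 sin0 mulr1. Qed.

Lemma normc_cexp z : normc (cexp z) = expR (complex.Re z).
Proof.
rewrite /cexp Normc.normcM normcR gtr0_norm ?expR_gt0//=.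
by rewrite cos2Dsin2 sqrtr1 mulr1.
Qed.

Lemma cexp_neq0 z : cexp z != 0.
Proof. by rewrite -normc_gt0 normc_cexp expR_gt0. Qed.

Lemma cexp0 : cexp 0 = 1 :> R[i].
Proof. by rewrite -[0]/(0%:C) cexpR expR0. Qed.

Lemma cexpMn z n : cexp (z *+ n) = cexp z ^+ n.
Proof. by elim: n => [|n IH]; rewrite ?cexp0// mulrS cexpD IH exprS. Qed.

Lemma ler_norm_sin x : `|sin x| <= `|x|.
Proof.
wlog x0 : x / 0 <= x => [H|].
  case: (leP 0 x) => [/H//|xlt0].
  by rewrite -normrN -sinN -(normrN x) H// oppr_ge0 ltW.
have [|c _] := @MVT_segment R sin cos 0 x x0.
  by apply: continuous_subspaceT => y; exact: continuous_sin.
rewrite sin0 !subr0 => ->; rewrite normrM ler_piMl//; exact: cos_max.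
Qed.

Lemma ler_norm_cosB1 x : `|cos x - 1| <= x ^+ 2.
Proof.
wlog x0 : x / 0 <= x => [H|].
  case: (leP 0 x) => [/H//|xlt0].
  by rewrite -cosN -sqrrN H// oppr_ge0 ltW.
have [|c cx] := @MVT_segment R cos (fun y => - sin y) 0 x x0.
  by apply: continuous_subspaceT => y; exact: continuous_cos.
rewrite cos0 subr0 => ->; rewrite normrM normrN (ger0_norm x0) expr2 ler_wpM2r//.
rewrite (le_trans (ler_norm_sin _))//; move: cx; rewrite in_itv/= => /andP[c0 cx].
by rewrite ger0_norm.
Qed.

Lemma ler_norm_sinB x : `|x| <= 1 -> `|sin x - x| <= x ^+ 2.
Proof.
wlog x0 : x / 0 <= x => [H|].
  case: (leP 0 x) => [/H//|xlt0] x1.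
  rewrite -normrN (_ : - (sin x - x) = sin (- x) - (- x)); last by rewrite sinN; ring.
  by rewrite -sqrrN H ?normrN// oppr_ge0 ltW.
rewrite ger0_norm// => x1.
have [|c cx] := @MVT_segment R (fun y => sin y - y) (fun y => cos y - 1) 0 x x0.
  apply: continuous_subspaceT => y; apply: cvgB; last exact: cvg_id.
  exact: continuous_sin.
rewrite sin0 !subr0 => ->; rewrite normrM (ger0_norm x0) expr2 ler_wpM2r//.
rewrite (le_trans (ler_norm_cosB1 _))//; move: cx; rewrite in_itv/= => /andP[c0 cx].
by nra.
Qed.

Lemma ler_norm_expRB1 x : `|x| <= 1 / 2 -> `|expR x - 1 - x| <= 2 * x ^+ 2.
Proof.
rewrite ler_norml => /andP[x1 x2]; have e1 := expR_ge1Dx x.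
rewrite ger0_norm; last by lra.
have e2 : expR x <= (1 - x)^-1.
  rewrite -[expR x]invrK -expRN lef_pV2 ?posrE ?expR_gt0//; last by lra.
  exact: expR_ge1Dx.
have e3 : (1 - x)^-1 <= 1 + x + 2 * x ^+ 2.
  rewrite -[leLHS]mul1r ler_pdivrMr; last by lra.
  by have := sqr_ge0 x; nra.
by lra.
Qed.

(** Real and imaginary parts are estimated separately by the second order bounds for the real
    functions; the constant 8 is generous. *)
Lemma normc_cexpB1_le h : normc h <= 1 / 2 -> normc (cexp h - 1 - h) <= 8 * normc h ^+ 2.
Proof.
have ha := ler_normRe h; have hb := ler_normIm h; move: ha hb.
have := sqr_normcE h; have := normc_ge0 h; move: (normc h) => r r0.
move=> e ha hb r2; rewrite (le_trans (ler_normcReIm _))//; move: e ha hb r2.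
case: h => a b /= e ha hb r2.
have a2 : `|a| <= 1 / 2 by lra.
have b1 : `|b| <= 1 by lra.
have ea := ler_norm_expRB1 a2; have cb := ler_norm_cosB1 b; have sb := ler_norm_sinB b1.
have e2 : expR a <= 2.
  move: ea a2; rewrite !ler_norml => /andP[_ ea] /andP[_ a2].
  have : a ^+ 2 <= r ^+ 2 by rewrite e lerDl sqr_ge0.
  by nra.
have e0 := expR_ge0 a; rewrite !mul0r !subr0 !addr0.
have -> : expR a * cos b - 1 - a = (expR a - 1 - a) + expR a * (cos b - 1) by ring.
have -> : expR a * sin b - b = expR a * (sin b - b) + (expR a - 1 - a) * b + a * b by ring.
have h1 : `|expR a - 1 - a + expR a * (cos b - 1)| <= 2 * a ^+ 2 + 2 * b ^+ 2.
  rewrite (le_trans (ler_normD _ _))// normrM (ger0_norm e0) lerD// ler_pM//.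
have h2 : `|expR a * (sin b - b) + (expR a - 1 - a) * b + a * b| <=
    2 * b ^+ 2 + 2 * a ^+ 2 * 1 + `|a| * `|b|.
  rewrite (le_trans (ler_normD _ _))// normrM lerD// (le_trans (ler_normD _ _))//.
  by rewrite !normrM (ger0_norm e0) lerD// ler_pM.
have h3 : `|a| * `|b| <= r ^+ 2 by rewrite expr2 ler_pM.
by have := sqr_ge0 r; lra.
Qed.

Lemma subrX_normc_le u v (m : R) n : normc u <= m -> normc v <= m -> 1 <= m ->
  normc (u ^+ n - v ^+ n) <= n%:R * m ^+ n * normc (u - v).
Proof.
move=> um vm m1; have m0 : 0 <= m by lra.
elim: n => [|n IH]; first by rewrite subrr Normc.normc0 !mul0r.
have -> : u ^+ n.+1 - v ^+ n.+1 = u * (u ^+ n - v ^+ n) + (u - v) * v ^+ n.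
  by rewrite !exprS; ring.
rewrite (le_trans (ler_normcD _ _))// !Normc.normcM normcX.
have h1 := ler_pM (normc_ge0 _) (normc_ge0 _) um IH.
have vn : normc v ^+ n <= m * m ^+ n.
  have : normc v ^+ n <= m ^+ n by apply: lerXn2r; rewrite ?nnegrE ?normc_ge0.
  by have := exprn_ge0 n m0; nra.
have h2 := ler_wpM2l (normc_ge0 (u - v)) vn.
rewrite (le_trans (lerD h1 h2))// exprS -natr1; rewrite le_eqVlt; apply/orP; left; apply/eqP; ring.
Qed.

(** Compares the n-th powers of [1 + z / n] and [e^(z / n)]: both bases have modulus at most
    [e^(K / n)] and they differ by O(1 / n^2). The condition [2 K <= n] gives [|z / n| <= 1 / 2], as
    [normc_cexpB1_le] requires. *)
Lemma cexp_approx (K : R) n z : (0 < n)%N -> normc z <= K -> 2 * K <= n%:R ->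
  normc ((1 + z / n%:R) ^+ n - cexp z) <= 8 * K ^+ 2 * expR K / n%:R.
Proof.
move=> n0 zK Kn; have nR : 0 < n%:R :> R by rewrite ltr0n.
have nC : n%:R != 0 :> R[i] by rewrite pnatr_eq0 -lt0n.
set h := z / n%:R; have zE : z = h *+ n by rewrite -mulr_natr divfK.
have K0 : 0 <= K by rewrite (le_trans _ zK)// normc_ge0.
have nh : normc h <= K / n%:R.
  rewrite Normc.normcM Normc.normcV -(rmorph_nat (real_complex R)) normcR gtr0_norm//.
  by rewrite ler_wpM2r// invr_ge0 ltW.
have Kn2 : K / n%:R <= 1 / 2 by rewrite ler_pdivrMr//; lra.
have eKn : expR (K / n%:R) ^+ n = expR K by rewrite -expRM_natr divfK// gt_eqF.
have h1 : normc (1 + h) <= expR (K / n%:R).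
  rewrite (le_trans (ler_normcD _ _))// Normc.normc1.
  by rewrite (le_trans _ (expR_ge1Dx _))// lerD2l.
have h2 : normc (cexp h) <= expR (K / n%:R).
  rewrite normc_cexp ler_expR (le_trans _ nh)// (le_trans (ler_norm _))//.
  exact: ler_normRe.
have h3 : 1 <= expR (K / n%:R) by rewrite (le_trans _ (expR_ge1Dx _))// lerDl divr_ge0// ltW.
rewrite zE cexpMn (le_trans (subrX_normc_le n h1 h2 h3))// eKn.
have h4 : normc (1 + h - cexp h) <= 8 * (K / n%:R) ^+ 2.
  rewrite normcBC opprD addrA (le_trans (normc_cexpB1_le (le_trans nh Kn2)))//.
  by rewrite ler_wpM2l//; apply: lerXn2r; rewrite ?nnegrE ?normc_ge0// divr_ge0// ltW.
rewrite (le_trans (ler_wpM2l _ h4)) ?mulr_ge0 ?expR_ge0//; rewrite le_eqVlt; apply/orP; left; apply/eqP.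
by field; rewrite gt_eqF.
Qed.

(** The derivative [(1 + w) e^w] vanishes only at -1. With [u = v + h] the equation becomes [h (z +
    1) + h (v - z) + h^2 + (v + h) E = 0] with [E = O(h^2)], and near z the term [h (z + 1)]
    outweighs the others. *)
Lemma mulc_cexp_local_inj z : z != -1 -> exists2 d : R, 0 < d &
  forall u v, normc (u - z) < d -> normc (v - z) < d ->
    u * cexp u = v * cexp v -> u = v.
Proof.
move=> z1; pose r := normc (z + 1).
have r0 : 0 < r by rewrite normc_gt0 addr_eq0.
(* For [|h| < 2 d <= 1 / 2] the other terms add up to at most [|h| d (7 + 16 |z|)], which is less
   than [|h| r] by this choice of d. *)
have [d [d0 d4 dr]] : exists d, [/\ 0 < d, d <= 1 / 4 & d * (60 * (1 + normc z)) <= r].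
  have z0 := normc_ge0 z.
  have q0 : 0 < 60 * (1 + normc z) by nra.
  exists (Num.min (1 / 4) (r / (60 * (1 + normc z)))).
  split; first by rewrite lt_min !divr_gt0.
    by rewrite ge_min lexx.
  by rewrite -ler_pdivlMr// ge_min lexx orbT.
exists d => // u v ud vd e; apply/eqP; rewrite -subr_eq0 -normc_eq0; apply/negPn/negP => k0.
set h := u - v in k0 *; have k0' : 0 < normc h by rewrite lt_def normc_ge0 k0.
have hd : normc h < 2 * d.
  rewrite /h -(subrKA z u) (le_lt_trans (ler_normcD _ _))// (normcBC z v); lra.
have uE : u = v + h by rewrite /h addrC subrK.
pose E := cexp h - 1 - h.
have hE : normc E <= 8 * normc h ^+ 2 by apply: normc_cexpB1_le; lra.
have : h * (v + 1) + h ^+ 2 + (v + h) * E = 0.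
  apply: (mulfI (cexp_neq0 v)); rewrite mulr0.
  have : (v + h) * (cexp v * cexp h) = v * cexp v by rewrite -cexpD -uE.
  rewrite (_ : cexp h = E + 1 + h); last by rewrite /E; ring.
  by move=> /eqP; rewrite -subr_eq0 => /eqP <-; ring.
have -> : h * (v + 1) = h * (z + 1) + h * (v - z) by ring.
move=> /eqP; rewrite -!addrA addr_eq0 => /eqP /(congr1 (fun x : R[i] => normc x)).
rewrite /= normcN Normc.normcM -/r.
have nu : normc (v + h) <= normc z + 1 / 4.
  by rewrite -uE -(subrK z u) addrC (le_trans (ler_normcD _ _))// lerD2l; lra.
have n3 := ler_pM (normc_ge0 _) (normc_ge0 _) nu hE.
have n1 := ler_normcD (h * (v - z)) (h ^+ 2 + (v + h) * E).
have n2 := ler_normcD (h ^+ 2) ((v + h) * E).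
rewrite !Normc.normcM -?expr2 in n1 n2.
move=> e'; have : normc h * r <= normc h * d + normc h ^+ 2 + (normc z + 1 / 4) * (8 * normc h ^+ 2).
  rewrite e' (le_trans n1)// -addrA; apply: lerD; first by rewrite ler_pM2l// ltW.
  by rewrite (le_trans n2)// lerD2l.
have -> : normc h * d + normc h ^+ 2 + (normc z + 1 / 4) * (8 * normc h ^+ 2) =
  normc h * (d + normc h * (3 + 8 * normc z)) by field.
rewrite ler_pM2l// => H.
have z0 := normc_ge0 z.
have : normc h * (3 + 8 * normc z) <= 2 * d * (3 + 8 * normc z).
  by rewrite ler_wpM2r; lra.
have : 0 < d * (1 + normc z) by nra.
by nra.
Qed.

End ComplexExp.

(** * The limiting equation for the ratios *)

Section ComplexLimits.
Variable R : realType.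
Implicit Types (z : R[i]).

(** A positive element of [R[i]] is real, so the complex epsilons of the norm topology may be taken
    in [R]. *)
Lemma cvgC_normcP (T : Type) (F : set_system T) {FF : Filter F} (u : T -> R[i]^o) (l : R[i]^o) :
  (u x @[x --> F] --> l) <-> (forall e : R, 0 < e -> \forall x \near F, normc (u x - l) < e).
Proof.
split=> [/cvgrPdist_lt H e e0|H]; last apply/cvgrPdist_lt => e e0.
  have := H e%:C; rewrite ltcR => /(_ e0); apply: filterS => x.
  by rewrite normr_normc ltcR normcBC.
have e0' : 0 < complex.Re e by move: e0; rewrite ltcE/= => /andP[].
apply: filterS (H _ e0') => x; rewrite normcBC normr_normc.
by move: e0; rewrite !ltcE/= => /andP[/eqP <- _] ->; rewrite eqxx.
Qed.

Lemma continuous_cexp : continuous (@cexp R : R[i]^o -> R[i]^o).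
Proof.
move=> z; have nz : Filter (nbhs (z : R[i]^o)) by exact: nbhs_filter.
apply: (proj2 (@cvgC_normcP _ _ nz _ _)) => e e0.
(* 5 bounds [1 + 8 |h|] for [|h| <= 1 / 2], hence [|e^h - 1| <= 5 |h|]. *)
pose K := normc (cexp z) * 5.
have K0 : 0 < K by rewrite mulr_gt0// normc_gt0 cexp_neq0.
pose d := Num.min (1 / 2) (e / K).
have d0 : 0 < d by rewrite lt_min !divr_gt0.
have := proj1 (@cvgC_normcP _ _ nz id z) cvg_id d d0.
apply: filterS => x xd; change (normc (cexp x - cexp z : R[i]) < e).
have /andP[x1 x2] : (normc (x - z) < 1 / 2) && (normc (x - z) < e / K).
  by rewrite -lt_min.
have E : cexp x - cexp z = cexp z * (cexp (x - z) - 1).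
  by rewrite mulrBr mulr1 -cexpD [z + _]addrC subrK.
rewrite E Normc.normcM; set h : R[i] := x - z in x1 x2 *.
have h1 : normc (cexp h - 1) <= normc h * 5.
  rewrite -(subrK h (cexp h - 1)) (le_trans (ler_normcD _ _))//.
  have := normc_cexpB1_le (ltW x1); have := normc_ge0 h; nra.
rewrite (le_lt_trans (ler_wpM2l (normc_ge0 _) h1))//.
by rewrite mulrCA -/K -ltr_pdivlMr.
Qed.

Lemma cvgC_ReIm (T : Type) (F : set_system T) {FF : Filter F} (u : T -> R[i]^o) (a b : R) :
  complex.Re (u x) @[x --> F] --> a -> complex.Im (u x) @[x --> F] --> b ->
  u x @[x --> F] --> (a +i* b : R[i]^o).
Proof.
move=> /cvgrPdist_lt ua /cvgrPdist_lt ub; apply/cvgC_normcP => e e0.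
have e2 : 0 < e / 2 by rewrite divr_gt0.
apply: filterS2 (ua _ e2) (ub _ e2) => x h1 h2.
rewrite normcBC (le_lt_trans (ler_normcReIm _))//.
by case: (u x) h1 h2 => p q /= h1 h2; lra.
Qed.

End ComplexLimits.

Section RatioLimit.
Variables (R : realType) (vartheta : R).
Hypothesis h1 : 1 <= vartheta.
Let h0 : 0 < vartheta. Proof. by rewrite (lt_le_trans _ h1). Qed.

Lemma natr_le_scale n : n%:R <= vartheta * n%:R :> R.
Proof. by rewrite ler_peMl. Qed.

(** For [theta = vartheta n] the power in [sratio_equation] is [(1 + z / n)^n] with
    [z = 1 / (vartheta r)], which is bounded because the ratios are bounded below. The estimate is
    kept at finite n so that it can be used before the ratios are known to converge. *)
Lemma sratio_defect (t : R[i]) : slit t ->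
  exists C : R, \forall n \near \oo,
    let r := sratio (vartheta * n%:R) n t in
    normc ((1 - t) * r - t * cexp ((vartheta%:C * r)^-1) * (1 - r)) <= C / n%:R.
Proof.
move=> st; have [C HC] := sratio_equation st; have [M HM] := sratio_le st.
have b0 := sratio_bound_gt0 st; pose K := (vartheta * sratio_bound t)^-1.
have K0 : 0 < K by rewrite invr_gt0 mulr_gt0.
exists (`|C| / vartheta + normc t * (8 * K ^+ 2 * expR K) * (1 + M)).
near=> n; set r := sratio (vartheta * n%:R) n t.
have n0 : (0 < n)%N by near: n; exact: nbhs_infty_gt.
have nR : 0 < n%:R :> R by rewrite ltr0n.
have nK : 2 * K <= n%:R by near: n; exact: nbhs_infty_ger.
have th0 : 0 < vartheta * n%:R by rewrite mulr_gt0.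
have nth := natr_le_scale n.
have rb : sratio_bound t <= normc r by exact: sratio_ge.
have r0 : r != 0 by rewrite -normc_gt0 (lt_le_trans b0).
have hz : (vartheta%:C * r)^-1 / n%:R = ((vartheta * n%:R)%:C * r)^-1.
  by rewrite rmorphM rmorph_nat -invfM mulrAC.
have zK : normc (vartheta%:C * r)^-1 <= K.
  rewrite Normc.normcV Normc.normcM normcR gtr0_norm// lef_pV2 ?posrE ?(pmulr_rgt0 _ h0)//.
    by rewrite ler_pM2l.
  exact: lt_le_trans rb.
have e1 := HC _ n th0 nth; have e2 := cexp_approx n0 zK nK.
rewrite -/r /= in e1; rewrite hz in e2.
have rM : normc (1 - r) <= 1 + M.
  by rewrite (le_trans (ler_normcB _ _))// Normc.normc1 lerD2l HM.
set p := (1 + _) ^+ n in e1 e2; set E := cexp _ in e2 *.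
have -> : (1 - t) * r - t * E * (1 - r) =
    ((1 - t) * r - t * p * (1 - r)) + t * (p - E) * (1 - r) by ring.
rewrite (le_trans (ler_normcD _ _))// [leRHS]mulrDl; apply: lerD.
  rewrite (le_trans e1)// invfM mulrA ler_wpM2r ?invr_ge0 ?(ltW nR)//.
  by rewrite ler_wpM2r ?invr_ge0 ?(ltW h0)// ler_norm.
rewrite !Normc.normcM [leRHS]mulrAC; apply: ler_pM; rewrite ?mulr_ge0 ?normc_ge0//.
by rewrite -[leRHS]mulrA ler_wpM2l ?normc_ge0.
Unshelve. all: by end_near. Qed.

Lemma sratio_lim_equation (t a : R[i]) : slit t ->
  sratio (vartheta * n%:R) n t @[n --> \oo] --> (a : R[i]^o) ->
  a != 0 /\ (1 - t) * a = t * cexp ((vartheta%:C * a)^-1) * (1 - a).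
Proof.
move=> st ra; have b0 := sratio_bound_gt0 st.
have hC : vartheta%:C != 0 by rewrite fmorph_eq0 gt_eqF.
have a0 : a != 0.
  apply/eqP => a0; move: ra; rewrite a0 => /cvgC_normcP/(_ _ b0)[N _ HN].
  (* [maxn N 1] keeps the index positive, hence also [vartheta * n]. *)
  have /HN : (N <= maxn N 1)%N by rewrite leq_maxl.
  rewrite /= subr0; set n := maxn N 1.
  by rewrite ltNge sratio_ge ?mulr_gt0 ?natr_le_scale ?ltr0n ?leq_max ?orbT.
split=> //; apply/eqP; rewrite -subr_eq0; apply/eqP.
pose D n := let r := sratio (vartheta * n%:R) n t in
  (1 - t) * r - t * cexp ((vartheta%:C * r)^-1) * (1 - r) : R[i]^o.
have D1 : D n @[n --> \oo] --> (0 : R[i]^o).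
  apply/cvgC_normcP => e e0; have [C HC] := sratio_defect st.
  near=> n; rewrite subr0; apply: (@le_lt_trans _ _ (C / n%:R)); first by near: n.
  have n0 : 0 < n%:R :> R by rewrite ltr0n; near: n; exact: nbhs_infty_gt.
  by rewrite ltr_pdivrMr// mulrC -ltr_pdivrMr//; near: n; exact: nbhs_infty_gtr.
have D2 : D n @[n --> \oo] -->
    ((1 - t) * a - t * cexp ((vartheta%:C * a)^-1) * (1 - a) : R[i]^o).
  apply: (@cvgB _ R[i]^o); first by apply: (@cvgM R[i]); [exact: cvg_cst|exact: ra].
  apply: (@cvgM R[i]); last by apply: (@cvgB _ R[i]^o); [exact: cvg_cst|exact: ra].
  apply: (@cvgM R[i]); first exact: cvg_cst.
  apply: (@continuous_cvg nat R[i]^o R[i]^o \oo _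
    (fun n => (vartheta%:C * sratio (vartheta * n%:R) n t)^-1) (@cexp R)).
    exact: continuous_cexp.
  apply: (@cvgV R[i]); first by rewrite mulf_neq0.
  by apply: (@cvgM R[i]); [exact: cvg_cst|exact: ra].
exact: (cvg_unique _ D2 D1).
Unshelve. all: by end_near. Qed.

End RatioLimit.

(** * Means over the zeros *)

Section Mean.
Variable R : realType.
Implicit Types (s : seq R) (f g : R -> R).

Definition mean s f : R := (\sum_(x <- s) f x) / (size s)%:R.

Lemma meanD s f g : mean s (fun x => f x + g x) = mean s f + mean s g.
Proof. by rewrite /mean big_split/= mulrDl. Qed.

Lemma meanZ s (k : R) f : mean s (fun x => k * f x) = k * mean s f.
Proof. by rewrite /mean -mulr_sumr mulrA. Qed.

Lemma mean_cst s (k : R) : (0 < size s)%N -> mean s (fun=> k) = k.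
Proof.
move=> s0; rewrite /mean big_const_seq count_predT iter_addr_0 -[k *+ _]mulr_natr mulfK//.
by rewrite pnatr_eq0 -lt0n.
Qed.

Lemma eq_mean s f g : {in s, f =1 g} -> mean s f = mean s g.
Proof. by move=> fg; rewrite /mean (eq_big_seq _ fg). Qed.

Lemma ler_mean s f g : {in s, forall x, f x <= g x} -> mean s f <= mean s g.
Proof.
move=> fg; rewrite /mean ler_wpM2r ?invr_ge0// big_seq [leRHS]big_seq.
exact: ler_sum.
Qed.

Lemma mean_norm_le s f (k : R) : 0 <= k -> {in s, forall x, `|f x| <= k} ->
  `|mean s f| <= k.
Proof.
move=> k0 fk; rewrite /mean normrM normfV [`|_%:R|]ger0_norm//.
have [->|s0] := posnP (size s); first by rewrite invr0 mulr0.
rewrite ler_pdivrMr ?ltr0n// (le_trans (ler_norm_sum _ _ _))//.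
have -> : k * (size s)%:R = \sum_(x <- s) k.
  by rewrite big_const_seq count_predT iter_addr_0 mulr_natr.
rewrite big_seq [leRHS]big_seq; exact: ler_sum.
Qed.

Lemma cvgn_cauchy (u : R^nat) :
  (forall e, 0 < e -> exists x, \forall n \near \oo, `|u n - x| < e) -> cvgn u.
Proof.
move=> H; apply/cauchy_cvgP; apply: cauchy_exP => e e0.
have [x Hx] := H e e0; exists x; apply: filterS Hx => n; by rewrite distrC.
Qed.

End Mean.

(** * Means of 1 / (t + x): convergence for 0 < t < 1 and a bound for t > 1 *)

Section ZeroMeans.
Variables (R : realType) (vartheta : R) (xs : nat -> seq R).
Hypothesis h1 : 1 <= vartheta.
Hypothesis xs_ge0 : forall n, (0 < n)%N -> all (>= 0) (xs n).
Hypothesis size_xs : forall n, (0 < n)%N -> size (xs n) = n.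
Hypothesis xsE : forall n, (0 < n)%N -> exists2 c : R[i], c != 0 &
  sibuya_poly (vartheta * n%:R)%:C n = roots_poly c [seq x%:C | x <- xs n].

Let h0 : 0 < vartheta. Proof. by rewrite (lt_le_trans _ h1). Qed.

Lemma sratio_mean n (t : R[i]) : (0 < n)%N -> slit t ->
  sratio (vartheta * n%:R) n t = t * (1 + (1 - t) / vartheta%:C *
    (mean (xs n) (fun x => complex.Re (t + x%:C)^-1) +i*
     mean (xs n) (fun x => complex.Im (t + x%:C)^-1))).
Proof.
move=> n0 st; have [c c0 e] := xsE n0; have nR : 0 < n%:R :> R by rewrite ltr0n.
rewrite (sratioE st _ c0 (xs_ge0 n0) e) ?mulr_gt0//; congr (t * (1 + _)).
have hC : vartheta%:C != 0 by rewrite fmorph_eq0 gt_eqF.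
have nC : n%:R != 0 :> R[i] by rewrite pnatr_eq0 -lt0n.
set S := \sum_(x <- _) _.
have -> : mean (xs n) (fun x => complex.Re (t + x%:C)^-1) +i*
     mean (xs n) (fun x => complex.Im (t + x%:C)^-1) = S / n%:R.
  rewrite /mean size_xs// -[RHS]mulrC -(rmorph_nat (real_complex R)) -fmorphV.
  rewrite -!raddf_sum -/S; case: (S) => a b /=.
  by apply/eqP; rewrite eq_complex/= !mul0r subr0 addr0 ![_^-1 * _]mulrC !eqxx.
by rewrite rmorphM rmorph_nat; field; rewrite hC nC.
Qed.

Lemma sratio_mean_real n (t : R) : (0 < n)%N -> 0 < t ->
  sratio (vartheta * n%:R) n t%:C =
  (t * (1 + (1 - t) / vartheta * mean (xs n) (fun x => (t + x)^-1)))%:C.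
Proof.
move=> n0 t0; rewrite sratio_mean//; last by rewrite /slit lecR -ltNge.
have E x : (t%:C + x%:C)^-1 = ((t + x)^-1)%:C by rewrite -rmorphD -fmorphV.
under [X in X +i* _]eq_mean => x _ do rewrite E/=.
under [X in _ +i* X]eq_mean => x _ do rewrite E/=.
rewrite /mean [in X in _ +i* X]big1// mul0r complexr0.
by rewrite -(rmorph1 (real_complex R)) -rmorphB -fmorphV -!rmorphM -rmorphD -!rmorphM.
Qed.

(** The means lie between 0 and [1 / t], and [vartheta >= 1]. The upper bound 1 is what makes
    [w = (1 - rho) / (vartheta rho)] nonnegative in [cvg_mean_inv]. *)
Lemma sratio_real_bounds n (t : R) : (0 < n)%N -> 0 < t -> t < 1 ->
  t <= t * (1 + (1 - t) / vartheta * mean (xs n) (fun x => (t + x)^-1)) <= 1.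
Proof.
move=> n0 t0 t1; set m := mean _ _.
have m0 : 0 <= m.
  rewrite -(@mean_cst _ (xs n) 0) ?size_xs//; apply: ler_mean => x /(allP (xs_ge0 n0)) x0.
  by rewrite invr_ge0 addr_ge0// ltW.
have mt : m <= t^-1.
  rewrite -(@mean_cst _ (xs n) t^-1) ?size_xs//; apply: ler_mean => x /(allP (xs_ge0 n0)) x0.
  by rewrite lef_pV2 ?posrE ?lerDl// ltr_wpDr.
have k0 : 0 <= (1 - t) / vartheta by rewrite divr_ge0 ?(ltW h0)// subr_ge0 ltW.
have kt : (1 - t) / vartheta <= 1 - t.
  by rewrite ler_pdivrMr// ler_peMr// subr_ge0 ltW.
apply/andP; split; first by rewrite ler_peMr ?(ltW t0)// lerDl mulr_ge0.
have km : (1 - t) / vartheta * m <= (1 - t) * t^-1 by rewrite ler_pM.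
rewrite [leRHS](_ : _ = t * (1 + (1 - t) * t^-1)); last by field; rewrite gt_eqF.
by rewrite ler_pM2l// lerD2l.
Qed.

(** The slope [(1 + w) e^w] is at least 1 for [w >= 0]. *)
Lemma mulr_expR_expanding (u v : R) : 0 <= u -> 0 <= v ->
  `|u - v| <= `|u * expR u - v * expR v|.
Proof.
wlog uv : u v / u <= v => [H|u0 v0].
  by case: (leP u v) => [/H//|/ltW/H H' ? ?]; rewrite distrC [leRHS]distrC H'.
have eu : 1 <= expR u by rewrite (le_trans _ (expR_ge1Dx _))// lerDl.
have euv : expR u <= expR v by rewrite ler_expR.
by rewrite ler0_norm ?subr_le0// ler0_norm ?subr_le0; nra.
Qed.

Lemma cvg_mean_inv (t : R) : 0 < t -> t < 1 ->
  cvgn (fun n => mean (xs n) (fun x => (t + x)^-1)).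
Proof.
move=> t0 t1; have st : slit t%:C by rewrite /slit lecR -ltNge.
pose m n := mean (xs n) (fun x => (t + x)^-1).
pose rho n := t * (1 + (1 - t) / vartheta * m n).
pose w n := (1 - rho n) / (vartheta * rho n).
have rhob n : (0 < n)%N -> t <= rho n <= 1 by move=> n0; exact: sratio_real_bounds.
have w0 n : (0 < n)%N -> 0 <= w n.
  move=> /rhob /andP[tr r1]; rewrite divr_ge0 ?subr_ge0// mulr_ge0 ?(ltW h0)//.
  by rewrite (le_trans _ tr)// ltW.
pose z := (1 - t) / (t * vartheta) * expR (- vartheta^-1).
have [C HC] := sratio_defect h1 st.
have wz : \forall n \near \oo, `|w n * expR (w n) - z| <= (C / (t * t)) / n%:R.
  near=> n.
  have n0 : (0 < n)%N by near: n; exact: nbhs_infty_gt.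
  have nR : 0 < n%:R :> R by rewrite ltr0n.
  have /andP[tr r1] := rhob _ n0; have r0 : 0 < rho n by rewrite (lt_le_trans t0).
  have : (fun n => let r := sratio (vartheta * n%:R) n t%:C in
    normc ((1 - t%:C) * r - t%:C * cexp ((vartheta%:C * r)^-1) * (1 - r)) <= C / n%:R) n.
    by near: n.
  rewrite /= sratio_mean_real// -/(m n) -/(rho n).
  rewrite -(rmorph1 (real_complex R)) -(rmorphM _ vartheta) -fmorphV cexpR.
  rewrite -!rmorphB -!rmorphM -rmorphB normcR => D.
  set d := _ - _ in D.
  have -> : w n * expR (w n) - z = - d / (t * rho n) * (expR (- vartheta^-1) / vartheta).
    have -> : w n = (vartheta * rho n)^-1 - vartheta^-1 by rewrite /w; field; rewrite !gt_eqF.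
    by rewrite expRD /d /z; field; rewrite !gt_eqF.
  have ev : expR (- vartheta^-1) / vartheta <= 1.
    rewrite ler_pdivrMr// mul1r (le_trans _ h1)// expR_le1 oppr_le0 invr_ge0 ltW//.
  have tt : t * t <= t * rho n by rewrite ler_pM2l.
  rewrite normrM normrM normrN normfV (gtr0_norm (mulr_gt0 t0 r0)).
  rewrite [X in _ * X]ger0_norm ?divr_ge0 ?expR_ge0 ?(ltW h0)//.
  apply: (@le_trans _ _ (`|d| / (t * rho n))).
    by rewrite ler_piMr// divr_ge0// mulr_ge0 ?ltW.
  rewrite mulrAC; apply: ler_pM => //; first by rewrite invr_ge0 mulr_ge0 ?ltW.
  by rewrite lef_pV2 // posrE; apply: mulr_gt0.
(* Two values of [w e^w] close to [z] force the arguments to be close to each other, so [w] is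
   Cauchy without any appeal to an inverse function. *)
have cw : cvgn w.
  apply: cvgn_cauchy => e e0.
  have [N _ HN] : \forall n \near \oo, (0 < n)%N /\ `|w n * expR (w n) - z| < e / 2.
    near=> n.
    have n0 : (0 < n)%N by near: n; exact: nbhs_infty_gt.
    have nR : 0 < n%:R :> R by rewrite ltr0n.
    split => //; apply: (@le_lt_trans _ _ (C / (t * t) / n%:R)); first by near: n.
    rewrite ltr_pdivrMr// [_ * n%:R]mulrC -ltr_pdivrMr ?divr_gt0//.
    by near: n; exact: nbhs_infty_gtr.
  have [N0 NN] := HN N (leqnn N); exists (w N); exists N => // n /= /HN[n0 nn].
  rewrite (le_lt_trans (mulr_expR_expanding (w0 _ n0) (w0 _ N0)))//.
  rewrite -(subrKA z) (le_lt_trans (ler_normD _ _))// (distrC z).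
  by rewrite (splitr e) ltrD.
(* Back from [w] to the means: [rho = 1 / (1 + vartheta w)], and the mean is an affine function of
   [rho]. *)
have crho : cvgn (fun n => (1 + vartheta * w n)^-1).
  have /cvg_ex[l wl] := cw; apply/cvg_ex; exists (1 + vartheta * l)^-1.
  apply: cvgV; last by apply: cvgD; [exact: cvg_cst|apply: cvgM; [exact: cvg_cst|exact: wl]].
  have l0 : 0 <= l.
    apply: (cvgr_to_ge wl); near=> n; apply: w0; near: n; exact: nbhs_infty_gt.
  by rewrite gt_eqF// ltr_pwDl// mulr_ge0// ltW.
have /cvg_ex[l rl] := crho; apply/cvg_ex.
exists (vartheta / (1 - t) * (l / t - 1)).
have : vartheta / (1 - t) * ((1 + vartheta * w n)^-1 / t - 1) @[n --> \oo]
    --> vartheta / (1 - t) * (l / t - 1).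
  apply: cvgM; first exact: cvg_cst.
  apply: cvgB; last exact: cvg_cst.
  by apply: cvgM; [exact: rl|exact: cvg_cst].
apply: cvg_trans; apply: near_eq_cvg; near=> n.
have n0 : (0 < n)%N by near: n; exact: nbhs_infty_gt.
have /andP[tr r1] := rhob _ n0; have r0 : 0 < rho n by rewrite (lt_le_trans t0).
have -> : (1 + vartheta * w n)^-1 = rho n.
  have -> : 1 + vartheta * w n = (rho n)^-1 by rewrite /w; field; rewrite !gt_eqF.
  by rewrite invrK.
rewrite /rho -/(m n); field; rewrite !gt_eqF// subr_gt0//.
Unshelve. all: by end_near. Qed.

(* 1 - (t - 1) I is the limit of the means of (1 + x) / (t + x). *)
Lemma cvg_mean_le (t I : R) : 1 < t ->
  mean (xs n) (fun x => (t + x)^-1) @[n --> \oo] --> I ->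
  (1 - (t - 1) * I) ^+ 2 <= vartheta / t.
Proof.
move=> t1 mI; have t0 : 0 < t by lra.
have st : slit t%:C by rewrite /slit lecR -ltNge.
pose a := t * (1 + (1 - t) / vartheta * I).
have ra : sratio (vartheta * n%:R) n t%:C @[n --> \oo] --> (a%:C : R[i]^o).
  have : t * (1 + (1 - t) / vartheta * mean (xs n) (fun x => (t + x)^-1)) @[n --> \oo] --> a.
    apply: cvgM; first exact: cvg_cst.
    apply: cvgD; first exact: cvg_cst.
    by apply: cvgM; [exact: cvg_cst|exact: mI].
  move=> /cvgrPdist_lt H; apply/cvgC_normcP => e /H He; near=> n.
  have n0 : (0 < n)%N by near: n; exact: nbhs_infty_gt.
  by rewrite sratio_mean_real// -rmorphB normcR distrC; near: n.
have [a0 E] := sratio_lim_equation h1 st ra.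
have I0 : 0 <= I.
  apply: (cvgr_to_ge mI); near=> n.
  have n0 : (0 < n)%N by near: n; exact: nbhs_infty_gt.
  rewrite -(@mean_cst _ (xs n) 0) ?size_xs//; apply: ler_mean => x /(allP (xs_ge0 n0)) x0.
  by rewrite invr_ge0 addr_ge0// ltW.
have It : (t - 1) * I <= 1.
  have : (t - 1) * mean (xs n) (fun x => (t + x)^-1) @[n --> \oo] --> (t - 1) * I.
    by apply: cvgM; [exact: cvg_cst|exact: mI].
  move/cvgr_to_le; apply; near=> n.
  have n0 : (0 < n)%N by near: n; exact: nbhs_infty_gt.
  rewrite -meanZ -[leRHS](@mean_cst _ (xs n) 1) ?size_xs//.
  apply: ler_mean => x /(allP (xs_ge0 n0)) x0.
  by rewrite ler_pdivrMr ?ltr_wpDr//; lra.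
set J := 1 - (t - 1) * I; have J0 : 0 <= J by rewrite subr_ge0.
have aE : a = t * (vartheta - 1 + J) / vartheta.
  by rewrite /a /J; field; rewrite gt_eqF.
have a1 : 0 < a.
  rewrite lt_def; apply/andP; split; first by apply: contraNneq a0 => ->.
  by rewrite aE divr_ge0 ?(ltW h0)// mulr_ge0 ?(ltW t0)// addr_ge0 ?subr_ge0.
have x0 : 0 < (vartheta * a)^-1 by rewrite invr_gt0 mulr_gt0.
move: E; rewrite -(rmorph1 (real_complex R)) -!rmorphB -!rmorphM -fmorphV cexpR -!rmorphM.
move=> /complexI E.
have e0 := expR_ge1Dx (vartheta * a)^-1.
have ax : a * (vartheta * a)^-1 = vartheta^-1 by field; rewrite !gt_eqF.
set x := (vartheta * a)^-1 in x0 e0 ax E; set e := expR x in e0 E.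
have agt1 : 0 < a - 1.
  have : 0 < (t * e) * (a - 1).
    rewrite (_ : t * e * (a - 1) = (t - 1) * a); last by lra.
    by rewrite mulr_gt0// subr_gt0.
  by rewrite pmulr_rgt0// mulr_gt0// expR_gt0.
(* Of the exponential only [e^x >= 1 + x] is used: with [a x = 1 / vartheta] the equation
   [t e^x (a - 1) = (t - 1) a] yields [J a <= 1], and [a >= t J / vartheta] then bounds [J^2]. *)
have h2 : (1 + x) * (a - 1) <= e * (a - 1) by rewrite ler_pM2r.
have h3 : t * ((1 + x) * (a - 1)) <= t * (e * (a - 1)) by rewrite ler_pM2l.
have h4 : a <= t * (1 - vartheta^-1) + t * x by rewrite -ax; lra.
have h5 : t * J / vartheta <= t * x.
  move: h4; rewrite {1}aE; have -> : t * (vartheta - 1 + J) / vartheta =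
    t * J / vartheta + t * (1 - vartheta^-1) by field; rewrite gt_eqF.
  by lra.
have h6 : J * a <= 1.
  have : t / vartheta * (J * a) <= t / vartheta * 1.
    rewrite mulr1 (_ : t / vartheta * (J * a) = t * J / vartheta * a); last by ring.
    rewrite (_ : t / vartheta = t * x * a); first by rewrite ler_pM2r.
    by rewrite -mulrA [x * a]mulrC ax.
  by rewrite ler_pM2l ?divr_gt0.
rewrite -[leLHS]mulr1 (_ : vartheta / t = (t / vartheta)^-1); last by rewrite invf_div.
rewrite -[leRHS]mul1r ler_pdivlMr ?divr_gt0// mulr1 (le_trans _ h6)// expr2 -mulrA.
rewrite ler_wpM2l// aE mulrA; apply: ler_wpM2r; first by rewrite invr_ge0 ltW.
by rewrite mulrC ler_pM2l// lerDr subr_ge0.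
Unshelve. all: by end_near. Qed.

End ZeroMeans.

(** * Bernstein approximation, and means of Lipschitz functions of 1 / (1 + x) *)

Section Bernstein.
Variable R : realType.
Implicit Types (g : nat -> R) (y : R).

(* The Bernstein polynomial sum_k C(n,k) y^k (1 - y)^(n-k) g k. *)
Fixpoint bernstein n g y : R :=
  if n is m.+1 then y * bernstein m (g \o S) y + (1 - y) * bernstein m g y else g 0%N.

(** The last factor is the mean of [(k - m)^2] for k binomial with parameters n and y. The induction
    on n shifts [g], which is why [m] is an arbitrary real. *)
Lemma bernstein_approx n g y (A B c m : R) : 0 <= y <= 1 ->
  (forall k, `|g k - c| <= A + B * (k%:R - m) ^+ 2) ->
  `|bernstein n g y - c| <= A + B * (n%:R * y * (1 - y) + (n%:R * y - m) ^+ 2).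
Proof.
move=> /andP[y0 y1]; elim: n g m => [|n IH] g m gc.
  by have := gc 0%N; rewrite mulr0n !mul0r !add0r.
have h1 : `|bernstein n (g \o S) y - c| <= A + B * (n%:R * y * (1 - y) + (n%:R * y - (m - 1)) ^+ 2).
  apply: IH => k; rewrite (_ : k%:R - (m - 1) = k.+1%:R - m); first exact: gc.
  by rewrite -natr1; ring.
have h0 := IH g m gc.
have -> : bernstein n.+1 g y - c =
    y * (bernstein n (g \o S) y - c) + (1 - y) * (bernstein n g y - c) by rewrite /=; ring.
have y1' : 0 <= 1 - y by rewrite subr_ge0.
rewrite (le_trans (ler_normD _ _))// !normrM (ger0_norm y0) (ger0_norm y1').
rewrite (le_trans (lerD (ler_wpM2l y0 h1) (ler_wpM2l y1' h0)))//.
by rewrite le_eqVlt; apply/orP; left; apply/eqP; rewrite -natr1; ring.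
Qed.

End Bernstein.

Section MeanConvergence.
Variables (R : realType) (xs : nat -> seq R).
Hypothesis xs_ge0 : forall n, (0 < n)%N -> all (>= 0) (xs n).
Hypothesis size_xs : forall n, (0 < n)%N -> size (xs n) = n.
Hypothesis cvg_inv : forall t, 0 < t -> t < 1 ->
  cvgn (fun n => mean (xs n) (fun x => (t + x)^-1)).

Let y (x : R) : R := (1 + x)^-1.

Let y_itv x : 0 <= x -> 0 <= y x <= 1.
Proof.
by move=> x0; rewrite invr_ge0 invf_le1 ?lerDl ?addr_ge0 ?x0 ?ltr_pwDl.
Qed.

Lemma cvg_mean_uniform (f : R -> R) :
  (forall e, 0 < e -> exists2 g, cvgn (fun n => mean (xs n) g) &
    forall x, 0 <= x -> `|f x - g x| <= e) ->
  cvgn (fun n => mean (xs n) f).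
Proof.
move=> H; apply: cvgn_cauchy => e e0; have e2 : 0 < e / 2 by rewrite divr_gt0.
have [g /cvg_ex[l gl] fg] := H _ e2; exists l; near=> n.
have n0 : (0 < n)%N by near: n; exact: nbhs_infty_gt.
rewrite -(subrKA (mean (xs n) g)) (le_lt_trans (ler_normD _ _))// (splitr e) ler_ltD//.
  have -> : mean (xs n) f - mean (xs n) g = mean (xs n) (fun x => f x + (-1) * g x).
    by rewrite meanD meanZ mulN1r.
  apply: mean_norm_le => [|x /(allP (xs_ge0 n0)) x0]; first exact: ltW.
  by rewrite mulN1r fg.
by rewrite distrC; near: n; move/cvgrPdist_lt: gl; exact.
Unshelve. all: by end_near. Qed.

Lemma cvg_mean_lin (a b : R) f g :
  cvgn (fun n => mean (xs n) f) -> cvgn (fun n => mean (xs n) g) ->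
  cvgn (fun n => mean (xs n) (fun x => a * f x + b * g x)).
Proof.
move=> /cvg_ex[l fl] /cvg_ex[m gm]; apply/cvg_ex; exists (a * l + b * m).
under eq_fun do rewrite meanD !meanZ.
by apply: cvgD; apply: cvgM; [exact: cvg_cst|exact: fl|exact: cvg_cst|exact: gm].
Qed.

Lemma eq_cvg_mean f g : (forall x, 0 <= x -> f x = g x) ->
  cvgn (fun n => mean (xs n) f) -> cvgn (fun n => mean (xs n) g).
Proof.
move=> fg /cvg_ex[l fl]; apply/cvg_ex; exists l.
apply: cvg_trans fl; apply: near_eq_cvg; near=> n.
have n0 : (0 < n)%N by near: n; exact: nbhs_infty_gt.
by apply: eq_mean => x /(allP (xs_ge0 n0)) x0; rewrite -fg.
Unshelve. all: by end_near. Qed.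

(* y / (1 - s y) = 1 / ((1 - s) + x) for y = 1 / (1 + x) *)
Lemma cvg_mean_geometric j (s : R) : 0 < s -> s < 1 ->
  cvgn (fun n => mean (xs n) (fun x => (1 + x)^-1 ^+ j.+1 / (1 - s * (1 + x)^-1))) /\
  cvgn (fun n => mean (xs n) (fun x => (1 + x)^-1 ^+ j.+1)).
Proof.
(* [y^(i+1)] is the uniform limit of [y^(i+1) / (1 - s y)] as s tends to 0. *)
have power i : (forall s, 0 < s -> s < 1 ->
    cvgn (fun n => mean (xs n) (fun x => (1 + x)^-1 ^+ i.+1 / (1 - s * (1 + x)^-1)))) ->
  cvgn (fun n => mean (xs n) (fun x => (1 + x)^-1 ^+ i.+1)).
  move=> H; apply: cvg_mean_uniform => e e0.
  have [r [r0 r1 re]] : exists r, [/\ 0 < r, r <= 1 / 2 & r <= e / 2].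
    exists (Num.min (1 / 2) (e / 2)).
    by rewrite lt_min !ge_min !lexx orbT !divr_gt0.
  exists (fun x => (1 + x)^-1 ^+ i.+1 / (1 - r * (1 + x)^-1)).
    by apply: H => //; lra.
  move=> x /y_itv; rewrite /y; set z := (1 + x)^-1 => /andP[z0 z1].
  have rz : r * z <= 1 / 2 by nra.
  have d0 : 0 < 1 - r * z by lra.
  have -> : z ^+ i.+1 - z ^+ i.+1 / (1 - r * z) = - (z ^+ i.+1 * (r * z) / (1 - r * z)).
    by field; rewrite gt_eqF.
  have rz0 : 0 <= r * z by rewrite mulr_ge0// ltW.
  have zi : z ^+ i.+1 <= 1 by rewrite exprn_ile1.
  rewrite normrN ger0_norm ?divr_ge0 ?mulr_ge0 ?exprn_ge0 ?(ltW d0) ?(ltW r0)//.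
  rewrite ler_pdivrMr//; have : z ^+ i.+1 * (r * z) <= 1 * (r * z) by rewrite ler_wpM2r.
  nra.
suff H i : forall s, 0 < s -> s < 1 ->
    cvgn (fun n => mean (xs n) (fun x => (1 + x)^-1 ^+ i.+1 / (1 - s * (1 + x)^-1))).
  by move=> s0 s1; split; [exact: H|exact: (power j (H j))].
elim: i => [|i IH] {}s s0 s1.
  apply: (eq_cvg_mean _ (cvg_inv (_ : 0 < 1 - s) (_ : 1 - s < 1))); [|lra|lra].
  move=> x x0; rewrite expr1; have x1 : 1 + x != 0 by rewrite gt_eqF// ltr_pwDl.
  have x2 : 1 - s + x != 0 by rewrite gt_eqF//; lra.
  have x3 : 1 + x - s != 0 by rewrite addrAC.
  by field; rewrite ?x1 ?x2 ?x3.
(* The exponent is raised by [y^(i+2) / (1 - s y) = (y^(i+1) / (1 - s y) - y^(i+1)) / s]. *)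
have h := @cvg_mean_lin s^-1 (- s^-1) _ _ (IH s s0 s1) (power i IH).
apply: eq_cvg_mean h => x x0; move: x0.
move=> /y_itv; rewrite /y; set z := (1 + x)^-1 => /andP[z0 z1].
have d0 : 1 - s * z != 0 by rewrite gt_eqF//; nra.
by rewrite !exprS; field; rewrite d0 gt_eqF.
Qed.

Lemma cvg_mean_pow j : cvgn (fun n => mean (xs n) (fun x => (1 + x)^-1 ^+ j)).
Proof.
case: j => [|j]; last by apply: (cvg_mean_geometric j (s := 1 / 2) _ _).2; lra.
apply/cvg_ex; exists 1; apply: cvg_near_cst; near=> n.
have n0 : (0 < n)%N by near: n; exact: nbhs_infty_gt.
by rewrite -[RHS](@mean_cst _ (xs n) 1) ?size_xs//.
Unshelve. all: by end_near. Qed.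

(** The factor [y^j], for [y = 1 / (1 + x)], is carried along because the recursion of [bernstein]
    multiplies by y. *)
Lemma cvg_mean_bernstein n g j :
  cvgn (fun k => mean (xs k) (fun x => (1 + x)^-1 ^+ j * bernstein n g (1 + x)^-1)).
Proof.
elim: n g j => [|n IH] g j.
  have h := @cvg_mean_lin (g 0%N) 0 _ _ (@cvg_mean_pow j) (@cvg_mean_pow j).
  by apply: eq_cvg_mean h => x _ /=; ring.
have h := @cvg_mean_lin 1 1 _ _ (IH (g \o S) j.+1)
  (@cvg_mean_lin 1 (-1) _ _ (IH g j) (IH g j.+1)).
by apply: eq_cvg_mean h => x _ /=; rewrite !exprS; ring.
Qed.

(** The Lipschitz bound is replaced by the quadratic one [L w <= L d + (L / d) w^2], to which
    [bernstein_approx] applies; [d] makes the first term at most [e / 2], and [N] then does so for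
    the variance term. *)
Lemma cvg_mean_lipschitz (f : R -> R) (L : R) :
  (forall u v, `|f u - f v| <= L * `|u - v|) ->
  cvgn (fun n => mean (xs n) (fun x => f (1 + x)^-1)).
Proof.
move=> fL; have L0 : 0 <= L.
  by have := fL 1 0; rewrite subr0 normr1 mulr1; apply: le_trans.
apply: cvg_mean_uniform => e e0.
have [d d0 dL] : exists2 d, 0 < d & L * d <= e / 2.
  exists (e / 2 / (1 + L)); first by rewrite !divr_gt0 ?ltr_pwDl.
  by rewrite mulrA ler_pdivrMr ?ltr_pwDl//; nra.
have [N /= N0 LN] : exists2 N, (0 < N)%N & L / d <= e / 2 * N%:R.
  exists (Num.bound (L / d / (e / 2))).+1 => //.
  rewrite [leRHS]mulrC -ler_pdivrMr ?divr_gt0//.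
  have b0 : 0 <= L / d / (e / 2) by rewrite !divr_ge0// ltW.
  by rewrite (le_trans (ltW (archi_boundP b0)))// ler_nat.
pose g k := f (k%:R / N%:R).
exists (fun x => (1 + x)^-1 ^+ 0 * bernstein N g (1 + x)^-1).
  exact: cvg_mean_bernstein.
move=> x x0; rewrite expr0 mul1r; move: (y_itv x0); rewrite /y; set z := (1 + x)^-1 => zI.
have NR : 0 < N%:R :> R by rewrite ltr0n.
have h k : `|g k - f z| <= L * d + L / d / N%:R ^+ 2 * (k%:R - N%:R * z) ^+ 2.
  rewrite (le_trans (fL _ _))//.
  have -> : L / d / N%:R ^+ 2 * (k%:R - N%:R * z) ^+ 2 = L * (`|k%:R / N%:R - z| ^+ 2 / d).
    by rewrite real_normK ?num_real//; field; rewrite !gt_eqF.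
  rewrite -mulrDr ler_wpM2l//; set w := `|_|.
  rewrite -subr_ge0 (_ : d + w ^+ 2 / d - w = ((w - d / 2) ^+ 2 + 3 / 4 * d ^+ 2) / d).
    rewrite divr_ge0 ?(ltW d0)//.
    by have := sqr_ge0 (w - d / 2); have := sqr_ge0 d; lra.
  by field; rewrite gt_eqF.
have := bernstein_approx N zI h; rewrite subrr expr0n addr0 distrC => /le_trans; apply.
rewrite (splitr e) lerD//.
have -> : L / d / N%:R ^+ 2 * (N%:R * z * (1 - z)) = (L / d) * (z * (1 - z)) / N%:R.
  by field; rewrite !gt_eqF.
rewrite ler_pdivrMr// (le_trans _ LN)// ler_piMr ?divr_ge0 ?(ltW d0)//.
by move: zI => /andP[z0 z1]; nra.
Qed.

End MeanConvergence.

(** * Quantile functions *)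

Section Steps.
Variable R : realType.
Local Notation P := (uniform_prob (@ltr01 R)).
Implicit Types (u : R) (c : nat -> R).

Definition slot (n j : nat) : set R := `[j%:R / n%:R, j.+1%:R / n%:R[%classic.

Definition step (n : nat) c u : R := \sum_(j < n) c j * \1_(slot n j) u.

Lemma uniform01E (U : set R) : measurable U ->
  P U = lebesgue_measure (U `&` `[0, 1]%classic).
Proof.
move=> mU; rewrite /uniform_prob/= integral_uniform_pdf.
rewrite (eq_integral (cst 1%E)); last first.
  move=> x; rewrite inE => -[_]; rewrite /= in_itv/= /uniform_pdf => ->.
  by rewrite subr0 invr1.
rewrite integral_cst ?mul1e//; exact: measurableI.
Qed.

Lemma slotP (n j : nat) u : (0 < n)%N ->
  slot n j u <-> (j%:R <= u * n%:R < j.+1%:R).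
Proof.
move=> n0; rewrite /slot /= in_itv/=.
by rewrite ler_pdivrMr ?ltr0n// ltr_pdivlMr ?ltr0n.
Qed.

Lemma slot_inj (n j k : nat) u : (0 < n)%N -> slot n j u -> slot n k u -> j = k.
Proof.
move=> n0 /(slotP _ _ n0)/andP[j1 j2] /(slotP _ _ n0)/andP[k1 k2].
apply/eqP; rewrite eqn_leq; apply/andP; split; rewrite -ltnS -(ltr_nat R).
  exact: le_lt_trans k2.
exact: le_lt_trans j2.
Qed.

Lemma slot_ex (n : nat) u : (0 < n)%N -> 0 <= u < 1 -> exists2 k, (k < n)%N & slot n k u.
Proof.
move=> n0 /andP[u0 u1]; have nR : 0 < n%:R :> R by rewrite ltr0n.
have un : 0 <= u * n%:R by rewrite mulr_ge0.
have /andP[t1 t2] := Num.Theory.truncn_itv un.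
exists (Num.truncn (u * n%:R)); last by apply/slotP; rewrite ?t1.
by rewrite -(ltr_nat R) (le_lt_trans t1)// gtr_pMl.
Qed.

Lemma stepE (n k : nat) c u : (k < n)%N -> slot n k u -> step n c u = c k.
Proof.
move=> kn uk; have n0 : (0 < n)%N by rewrite (leq_ltn_trans _ kn).
rewrite /step (bigD1 (Ordinal kn))//= indicE mem_set// mulr1 big1 ?addr0// => j jk.
rewrite indicE memNset ?mulr0// => uj; move/eqP: jk; apply.
by apply: val_inj => /=; exact: slot_inj uj uk.
Qed.

Lemma ae_unit : {ae P, forall u, 0 <= u < 1}.
Proof.
exists (~` `[0, 1[%classic); split; first exact: measurableC.
  rewrite [LHS]uniform01E; last exact: measurableC.
  apply/eqP; rewrite -measure_le0.
  rewrite -(lebesgue_measure_set1 (1 : R)) le_measure ?inE//.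
    by apply: measurableI => //; exact: measurableC.
  move=> x [/= + ]; rewrite !in_itv/= => + /andP[x0 x1]; rewrite x0/= => /negP.
  by rewrite -leNgt => x1'; apply/eqP; rewrite eq_le x1.
by move=> u /= H; rewrite in_itv.
Qed.

Lemma measure_slot (n j : nat) : (j < n)%N -> P (slot n j) = (n%:R^-1)%:E.
Proof.
move=> jn; have n0 : (0 < n)%N by rewrite (leq_ltn_trans _ jn).
have nR : 0 < n%:R :> R by rewrite ltr0n.
rewrite [LHS]uniform01E; last exact: measurable_itv.
rewrite (_ : _ `&` _ = slot n j); last first.
  apply/setIidPl => u /(slotP _ _ n0)/andP[u1 u2] /=; rewrite in_itv/=.
  have un : u * n%:R <= n%:R by rewrite (le_trans (ltW u2))// ler_nat.
  rewrite -(ler_pM2r nR) mul0r (le_trans _ u1)//=.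
  by rewrite -(ler_pM2r nR) mul1r.
rewrite lebesgue_measure_itv/= lte_fin ltr_pM2r ?invr_gt0// ltr_nat ltnSn.
by rewrite -EFinB -mulrBl -natrB// subSnn mul1r.
Qed.

Lemma measurable_step (n : nat) c : measurable_fun setT (step n c).
Proof.
apply: measurable_sum => j; apply: measurable_funM => //.
by apply: measurable_indic; exact: measurable_itv.
Qed.

Lemma integral_step (n : nat) c :
  (\int[P]_u (step n c u)%:E = ((\sum_(j < n) c j) / n%:R)%:E)%E.
Proof.
have mslot j : measurable (slot n j) by exact: measurable_itv.
have int_slot j : P.-integrable setT (fun u => (c j * \1_(slot n j) u)%:E).
  under eq_fun do rewrite EFinM.
  by apply: integrableZl => //; exact: (integrable_indic P (mslot j)).
under eq_integral do rewrite /step -sumEFin.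
rewrite integral_sum//.
rewrite mulr_suml -sumEFin; apply: eq_bigr => j _.
under eq_integral do rewrite EFinM.
rewrite integralZl//; last first.
  exact: (integrable_indic P (mslot j)).
rewrite integral_indic; [|exact: measurableT|exact: mslot].
transitivity ((c j)%:E * P (slot n j))%E; last by rewrite measure_slot.
congr (_ * _)%E; apply: congr1; exact: setIT.
Qed.

End Steps.

Section Gap.
Variable R : realType.

(** [sup S] is the lower limit. For rationals with [sup S < a < b < sup S + e] the first alternative
    would put [a] into [S], so the second holds. *)
Lemma cvgn_no_gap (u : nat -> R) : (forall n, 0 <= u n <= 1) ->
  (forall a b : rat, a < b ->
    (\forall n \near \oo, ratr a <= u n) \/ (\forall n \near \oo, u n <= ratr b)) ->
  cvgn u.
Proof.
move=> u01 gap; pose S := [set x : R | \forall n \near \oo, x <= u n].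
have S0 : S 0 by apply: nearW => n; have /andP[] := u01 n.
have S1 x : S x -> x <= 1.
  move=> [N _ HN]; have /= := HN N (leqnn N).
  by move/le_trans; apply; have /andP[] := u01 N.
have supS : has_sup S by split; [exists 0|exists 1 => x /S1].
apply/cvg_ex; exists (sup S); apply/cvgrPdist_lt => e e0.
have lo : \forall n \near \oo, sup S - e < u n.
  have [x Sx xe] := sup_adherent e0 supS.
  by apply: filterS Sx => n; exact: lt_le_trans.
have hi : \forall n \near \oo, u n < sup S + e.
  have Se : sup S < sup S + e by rewrite ltrDl.
  have [a] := rat_in_itvoo Se; rewrite in_itv/= => /andP[a1 a2].
  have [b] := rat_in_itvoo a2; rewrite in_itv/= => /andP[b1 b2].
  have ab : a < b by rewrite -(ltr_rat R).
  have [Sa|] := gap _ _ ab; last by apply: filterS => n /le_lt_trans; apply.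
  suff : ratr a <= sup S by rewrite leNgt a1.
  by apply: ub_le_sup => //; case: supS.
by apply: filterS2 lo hi => n h1 h2; rewrite ltr_norml; apply/andP; split; lra.
Qed.

(** For [a < b], a Lipschitz function between the indicators of [y <= a] and [y < b]; its means can
    therefore be compared with distribution functions. *)
Definition trap (a b y : R) : R := Num.max 0 (Num.min 1 ((b - y) / (b - a))).

Lemma trap_ge0 a b y : 0 <= trap a b y.
Proof. by rewrite le_max lexx. Qed.

Lemma trap_le1 a b y : trap a b y <= 1.
Proof. by rewrite ge_max ler01 ge_min lexx. Qed.

Lemma trap_eq1 a b y : a < b -> y <= a -> trap a b y = 1.
Proof.
move=> ab ya; have h : 1 <= (b - y) / (b - a).
  by rewrite ler_pdivlMr ?subr_gt0// mul1r lerB.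
by rewrite /trap (min_idPl h); apply/max_idPr.
Qed.

Lemma trap_eq0 a b y : a < b -> b <= y -> trap a b y = 0.
Proof.
move=> ab yb; apply/max_idPl; rewrite ge_min; apply/orP; right.
by rewrite ler_pdivrMr ?subr_gt0// mul0r subr_le0.
Qed.

Lemma trap_lipschitz a b : a < b ->
  forall u v, `|trap a b u - trap a b v| <= (b - a)^-1 * `|u - v|.
Proof.
move=> ab u v; have d0 : 0 < b - a by rewrite subr_gt0.
wlog uv : u v / u <= v => [H|].
  by case: (leP u v) => [/H//|/ltW/H]; rewrite distrC [in leRHS]distrC.
have -> : (b - a)^-1 * `|u - v| = (b - u) / (b - a) - (b - v) / (b - a).
  by rewrite distrC ger0_norm ?subr_ge0//; field; rewrite gt_eqF.
have : (b - v) / (b - a) <= (b - u) / (b - a) by rewrite ler_pM2r ?invr_gt0// lerB.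
rewrite /trap; move: (_ / _) (_ / _) => p q pq.
have mn (r s : R) : r <= s -> 0 <= Num.min 1 s - Num.min 1 r <= s - r.
  by move=> rs; case: (leP 1 r); case: (leP 1 s) => *; lra.
have mx (r s : R) : r <= s -> 0 <= Num.max 0 s - Num.max 0 r <= s - r.
  by move=> rs; case: (leP 0 r); case: (leP 0 s) => *; lra.
have /andP[n1 n2] := mn _ _ pq; rewrite subr_ge0 in n1.
have /andP[x1 x2] := mx _ _ n1.
by rewrite ger0_norm//; exact: le_trans n2.
Qed.

End Gap.

Section Quantiles.
Variables (R : realType) (xs : nat -> seq R) (K : R).
Hypothesis xs_ge0 : forall n, (0 < n)%N -> all (>= 0) (xs n).
Hypothesis size_xs : forall n, (0 < n)%N -> size (xs n) = n.
Hypothesis cvg_inv : forall t, 0 < t -> t < 1 ->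
  cvgn (fun n => mean (xs n) (fun x => (t + x)^-1)).
Hypothesis tight : forall t I, 1 < t ->
  mean (xs n) (fun x => (t + x)^-1) @[n --> \oo] --> I ->
  (1 - (t - 1) * I) ^+ 2 <= K / t.
Local Notation P := (uniform_prob (@ltr01 R)).

Global Instance filter_ae_unit : Filter (nbhs (almost_everywhere P)).
Proof. exact: (ae_filter_ringOfSetsType P). Qed.

(** Decreasing in x, so that [1 / (1 + x)] increases along the list. The default 0 makes
    nonnegativity hold at every index. *)
Definition desc (s : seq R) : nat -> R := nth 0 (sort (fun x y => y <= x) s).

Let X n := step n (desc (xs n)) : R -> R.
(** On [0, 1[ and for [n > 0], the quantile function of [1 / (1 + x)] for x drawn uniformly from
    [xs n]. *)
Let q n (u : R) : R := (1 + X n u)^-1.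

Lemma desc_ge0 s j : all (>= 0) s -> 0 <= desc s j.
Proof.
move=> /allP s0; rewrite /desc; set r := sort _ _.
have [jr|rj] := ltnP j (size r); last by rewrite nth_default.
by apply: s0; rewrite -(mem_sort (fun x y => y <= x)) mem_nth.
Qed.

Lemma desc_le s j k : (j <= k)%N -> (k < size s)%N -> desc s k <= desc s j.
Proof.
move=> jk ks; rewrite /desc.
have ts : transitive (fun x y : R => y <= x) by move=> a b c ba ac; exact: le_trans ac ba.
have tot : total (fun x y : R => y <= x) by move=> a b; exact: le_total.
have rf : reflexive (fun x y : R => y <= x) by move=> a; exact: lexx.
apply: (sorted_leq_nth ts rf 0 (sort_sorted tot s)) => //.
- by rewrite inE size_sort (leq_ltn_trans jk).
- by rewrite inE size_sort.
Qed.

Lemma mean_desc s F : mean s F = (\sum_(j < size s) F (desc s j)) / (size s)%:R.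
Proof.
rewrite /mean; congr (_ / _).
have E : perm_eq (sort (fun x y : R => y <= x) s) s by rewrite perm_sort.
rewrite -(perm_big _ E) /=.
by rewrite (big_nth 0) size_sort big_mkord.
Qed.

Let X_ge0 n u : 0 <= X n u.
Proof.
have [->|n0] := posnP n; first by rewrite /X /step big_ord0.
by apply: sumr_ge0 => j _; rewrite mulr_ge0// desc_ge0// xs_ge0.
Qed.

Let q01 n u : 0 <= q n u <= 1.
Proof.
by rewrite /q invr_ge0 addr_ge0 ?X_ge0//= invf_le1 ?lerDl ?X_ge0// ltr_pwDl ?X_ge0.
Qed.

(** For u in the k-th slot, the [k + 1] smallest values of [1 / (1 + x)] are at most [a] and
    contribute 1 each, and [u <= (k + 1) / n]. *)
Lemma le_mean_trap n u a b : a < b -> (0 < n)%N -> 0 <= u < 1 -> q n u <= a ->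
  u <= mean (xs n) (fun x => trap a b (1 + x)^-1).
Proof.
move=> ab n0 u01 qa; have [k kn uk] := slot_ex n0 u01.
rewrite mean_desc size_xs// ler_pdivlMr ?ltr0n//.
have /(slotP _ _ n0)/andP[_ /ltW/le_trans] := uk; apply.
have -> : k.+1%:R = \sum_(j < n | (j < k.+1)%N) 1 :> R.
  by rewrite -(big_ord_widen n (fun=> 1 : R))// sumr_const card_ord.
rewrite big_mkcond/=; apply: ler_sum => j _; case: ifPn => [jk|_]; last exact: trap_ge0.
rewrite trap_eq1//; apply: le_trans qa; rewrite /q /X (stepE _ kn uk).
rewrite lef_pV2 ?posrE ?ltr_pwDl ?desc_ge0 ?xs_ge0//.
by rewrite lerD2l; apply: desc_le; rewrite ?size_xs.
Qed.

(** For u in the k-th slot, at most the k smallest values of [1 / (1 + x)] contribute, and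
    [k / n <= u]. *)
Lemma mean_trap_le n u a b : a < b -> (0 < n)%N -> 0 <= u < 1 -> b <= q n u ->
  mean (xs n) (fun x => trap a b (1 + x)^-1) <= u.
Proof.
move=> ab n0 u01 qa; have [k kn uk] := slot_ex n0 u01.
rewrite mean_desc size_xs// ler_pdivrMr ?ltr0n//.
have /(slotP _ _ n0)/andP[ku _] := uk; apply: le_trans ku.
have -> : k%:R = \sum_(j < n | (j < k)%N) 1 :> R.
  by rewrite -(big_ord_widen n (fun=> 1 : R)) ?(ltnW kn)// sumr_const card_ord.
rewrite [leRHS]big_mkcond/=; apply: ler_sum => j _; case: ifPn => [jk|]; first exact: trap_le1.
rewrite -leqNgt => kj; rewrite trap_eq0//; apply: (le_trans qa); rewrite /q /X (stepE _ kn uk).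
rewrite lef_pV2 ?posrE ?ltr_pwDl ?desc_ge0 ?xs_ge0//.
by rewrite lerD2l; apply: desc_le; rewrite ?size_xs.
Qed.

(* A value u at which the quantiles do not converge is the limit of the means of some
   trapezoid function with rational parameters. *)
Let C : set R := range (fun ab : rat * rat =>
  limn (fun n => mean (xs n) (fun x => trap (ratr ab.1) (ratr ab.2) (1 + x)^-1))).

(** Let T be the limit of the means of the trapezoid function for rationals [a < b]. If [u < T] then
    eventually [q n u <= b]; if [u > T] then eventually [a <= q n u]. *)
Lemma cvg_quantile u : 0 <= u < 1 -> ~ C u -> cvgn (q ^~ u).
Proof.
move=> u01 Cu; apply: cvgn_no_gap => [n|a b ab]; first exact: q01.
have ab' : ratr a < ratr b :> R by rewrite ltr_rat.
set f := trap (ratr a) (ratr b) : R -> R.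
have cf : cvgn (fun n => mean (xs n) (fun x => f (1 + x)^-1)).
  apply: cvg_mean_lipschitz => //; exact: trap_lipschitz.
set T := limn (fun n => mean (xs n) (fun x => f (1 + x)^-1)) in cf.
have [uT|Tu|uT] := ltgtP u T; last by exfalso; apply: Cu; exists (a, b).
  right; near=> n; have n0 : (0 < n)%N by near: n; exact: nbhs_infty_gt.
  rewrite leNgt; apply/negP => /ltW/(mean_trap_le ab' n0 u01).
  by rewrite leNgt => /negP; apply; near: n; exact: (cvgr_gt T cf).
left; near=> n; have n0 : (0 < n)%N by near: n; exact: nbhs_infty_gt.
rewrite leNgt; apply/negP => /ltW/(le_mean_trap ab' n0 u01).
by rewrite leNgt => /negP; apply; near: n; exact: (cvgr_lt T cf).
Unshelve. all: by end_near. Qed.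

Let ae_cvg_quantile : {ae P, forall u, (0 <= u < 1) /\ cvgn (q ^~ u)}.
Proof.
have cC : countable C by apply: sub_countable (card_image_le _ _) _; exact: countableP.
have aeC : {ae P, forall u, ~ C u}.
  exists C; split; [exact: countable_measurable| |by move=> u /= /contrapT].
  rewrite [LHS]uniform01E; last exact: countable_measurable.
  apply: countable_lebesgue_measure0; apply: sub_countable cC.
  by apply: subset_card_le => x [].
move: (@ae_unit R) aeC; apply: filterS2 => u u01 Cu; split => //; exact: cvg_quantile.
Qed.

(** The upper limit is measurable on the whole line and is the limit wherever there is one. *)
Let q_lim u : R := limn_sup (q ^~ u).

Let q_limE u l : q ^~ u @ \oo --> l -> q_lim u = l.
Proof. by move=> ul; have /cvg_lim <-// := @cvg_sups _ (q ^~ u) l ul. Qed.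


Let measurable_q n : measurable_fun setT (q n).
Proof.
have -> : q n = (fun u => (1 + X n u) `^ (-1)).
  by apply/funext => u; rewrite powR_inv1// addr_ge0.
apply: (measurableT_comp (measurable_powR (-1))).
by apply: measurable_funD => //; exact: measurable_step.
Qed.

Let measurable_q_lim : measurable_fun setT q_lim.
Proof.
apply: measurable_fun_limn_sup => // u _.
  by exists 1 => _ [n _ <-]; have /andP[] := q01 n u.
by exists 0 => _ [n _ <-]; have /andP[] := q01 n u.
Qed.

Let ae_q_lim : {ae P, forall u, 0 <= u < 1 /\ q ^~ u @ \oo --> q_lim u}.
Proof.
move: ae_cvg_quantile; apply: filterS => u [u01 /cvg_ex[l ql]]; split => //.
by rewrite (q_limE ql).
Qed.

(** [mean (xs n) F] is the integral over [0, 1] of a step function, so dominated convergence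
    applies. [h] is a separate function because the limit is known only almost everywhere. *)
Lemma cvg_mean_dominated (F h : R -> R) (M : R) :
  (forall x, 0 <= x -> `|F x| <= M) -> measurable_fun setT h ->
  {ae P, forall u, (0 <= u < 1) -> F (X n u) @[n --> \oo] --> h u} ->
  P.-integrable setT (EFin \o h) /\
  (mean (xs n) F)%:E @[n --> \oo] --> (\int[P]_u (h u)%:E)%E.
Proof.
(* A step function is measurable whatever [F] is; for [n > 0] it agrees with [F \o X n] on [0,
   1[. *)
move=> FM mh Fh; pose f n := step n (F \o desc (xs n)) : R -> R.
have M0 : 0 <= M by rewrite (le_trans _ (FM 0 _)).
have fX n u : (0 < n)%N -> 0 <= u < 1 -> f n u = F (X n u).
  by move=> n0 u01; have [k kn uk] := slot_ex n0 u01; rewrite /f /X !(stepE _ kn uk).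
have ae1 : {ae P, forall u, setT u -> (fun n => (f n u)%:E) @ \oo --> (h u)%:E}.
  move: (@ae_unit R) Fh; apply: filterS2 => u u01 /(_ u01) Fhu _.
  apply: cvg_EFin; first by near=> n.
  apply: cvg_trans Fhu; apply: near_eq_cvg; near=> n; rewrite /= fX//.
  by near: n; exact: nbhs_infty_gt.
have ae2 : {ae P, forall u n, setT u -> (`|(f n u)%:E| <= M%:E)%E}.
  move: (@ae_unit R); apply: filterS => u u01 n _; rewrite lee_fin.
  have [->|n0] := posnP n; first by rewrite /f /step big_ord0 normr0.
  by rewrite fX// FM.
have iM : P.-integrable setT (fun=> M%:E).
  exact: finite_measure_integrable_cst.
have [] := dominated_convergence measurableT _ _ ae1 iM ae2.
- by move=> n; apply/measurable_EFinP; exact: measurable_step.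
- exact/measurable_EFinP.
move=> ih _ lim; split => //; apply: cvg_trans lim; apply: near_eq_cvg; near=> n.
have n0 : (0 < n)%N by near: n; exact: nbhs_infty_gt.
by rewrite /= /f integral_step mean_desc size_xs.
Unshelve. all: by end_near. Qed.

Let q_lim_ge0 u : 0 <= u < 1 -> q ^~ u @ \oo --> q_lim u -> 0 <= q_lim u.
Proof.
by move=> u01 /cvgr_to_ge; apply; apply: nearW => n; have /andP[] := q01 n u.
Qed.

(** Mass escaping to infinity would sit on the set [A] where the limit of [y = 1 / (1 + x)] is 0.
    There [(1 + x) / (t + x) = 1 / (1 + (t - 1) y)] tends to 1, so [P A] is at most the limit of the
    means of this function, whose square [tight] bounds by [K / t]. *)
Let q_lim_gt0 : {ae P, forall u, 0 < q_lim u}.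
Proof.
pose A := [set u | q_lim u <= 0].
have mA : measurable A.
  rewrite /A -[X in measurable X]setTI -preimage_itvNyc.
  by apply: measurable_q_lim => //; exact: measurable_itv.
have bound t : 1 < t -> (fine (P A)) ^+ 2 <= K / t.
  move=> t1; pose F x : R := (1 + (t - 1) * (1 + x)^-1)^-1.
  (* [Num.max] keeps the base at least 1 for every u, also off the set of convergence. *)
  pose h u := (1 + (t - 1) * Num.max 0 (q_lim u)) `^ (-1).
  have d0 y : 0 <= y -> 0 < 1 + (t - 1) * y.
    by move=> y0; rewrite ltr_pwDl// mulr_ge0// subr_ge0 ltW.
  have FM x : 0 <= x -> `|F x| <= 1.
    move=> x0; have y0 : 0 <= (1 + x)^-1 by rewrite invr_ge0 addr_ge0.
    rewrite /F ger0_norm ?invr_ge0 ?(ltW (d0 _ y0))// invf_le1 ?d0//.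
    by rewrite lerDl mulr_ge0// subr_ge0 ltW.
  have mh : measurable_fun setT h.
    apply: (measurableT_comp (measurable_powR (-1))).
    apply: measurable_funD => //; apply: measurable_funM => //.
    exact: measurable_maxr.
  have hE u : h u = (1 + (t - 1) * Num.max 0 (q_lim u))^-1.
    by rewrite /h powR_inv1// (ltW (d0 _ _))// le_max lexx.
  have [ih lim] : P.-integrable setT (EFin \o h) /\
      (mean (xs n) F)%:E @[n --> \oo] --> (\int[P]_u (h u)%:E)%E.
    apply: (cvg_mean_dominated FM mh); move: ae_q_lim; apply: filterS => u [u01 qu] _.
    have ql0 := q_lim_ge0 u01 qu; rewrite hE (max_idPr ql0).
    apply: cvgV; first by rewrite gt_eqF// d0.
    by apply: cvgD; [exact: cvg_cst|apply: cvgM; [exact: cvg_cst|exact: qu]].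
  have [L hL] : exists L : R, (\int[P]_u (h u)%:E)%E = L%:E.
    by exists (fine (\int[P]_u (h u)%:E)); rewrite fineK//; exact: integrable_fin_num.
  rewrite hL in lim.
  have limL : mean (xs n) F @[n --> \oo] --> L by exact: (fine_cvg lim).
  have limI : mean (xs n) (fun x => (t + x)^-1) @[n --> \oo] --> (1 - L) / (t - 1).
    have : (1 - mean (xs n) F) / (t - 1) @[n --> \oo] --> (1 - L) / (t - 1).
      by apply: cvgM; [apply: cvgB; [exact: cvg_cst|exact: limL]|exact: cvg_cst].
    apply: cvg_trans; apply: near_eq_cvg; near=> n.
    have n0 : (0 < n)%N by near: n; exact: nbhs_infty_gt.
    have t1' : t - 1 != 0 by rewrite gt_eqF// subr_gt0.
    rewrite -[X in X - _](@mean_cst _ (xs n) 1) ?size_xs// -[- mean _ _]mulN1r -meanZ -meanD mulrC -meanZ.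
    apply: eq_mean => x /(allP (xs_ge0 n0)) x0; rewrite /F.
    have x1 : 1 + x != 0 by rewrite gt_eqF// ltr_pwDl.
    have x2 : t + x != 0 by rewrite gt_eqF// ltr_wpDr// (lt_trans _ t1).
    have x3 : 1 + x + (t - 1) != 0 by rewrite addrC addrA subrK.
    by field; rewrite ?x1 ?x2 ?x3 ?t1'.
  have := tight t1 limI; rewrite mulrC divfK ?subKr; last by rewrite gt_eqF// subr_gt0.
  apply: le_trans; apply: lerXn2r; rewrite ?nnegrE ?fine_ge0//.
    by rewrite -lee_fin -hL integral_ge0// => u _; rewrite lee_fin hE invr_ge0 ltW// d0// le_max lexx.
  rewrite -lee_fin -hL fineK ?fin_num_measure//.
  have PAE : (\int[P]_u (\1_A u)%:E = P A)%E.
    by rewrite integral_indic//; apply: congr1; exact: setIT.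
  apply: (@le_trans _ _ (\int[P]_u (\1_A u)%:E)%E); first by rewrite PAE.
  apply: ge0_le_integral => //.
  - by apply/measurable_EFinP; exact: measurable_indic.
  - exact/measurable_EFinP.
  move=> u _; rewrite lee_fin hE indicE; have [uA|uA] := boolP (u \in A).
    by move: uA; rewrite inE => uA; rewrite (max_idPl uA) mulr0 addr0 invr1.
  by rewrite invr_ge0 ltW// d0// le_max lexx.
exists A; split => //; last by move=> u /= /negP; rewrite -leNgt.
have PA0 : 0 <= fine (P A) by rewrite fine_ge0.
apply/eqP; rewrite -[P A]fineK ?fin_num_measure// eqe eq_le PA0 andbT leNgt; apply/negP => p0.
set p := fine (P A) in bound PA0 p0.
have p20 : 0 < p ^+ 2 by rewrite exprn_gt0.
(* For this value of t one has [p^2 t = |K| + 2 p^2 > K], against [bound]. *)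
have t1 : 1 < `|K| / p ^+ 2 + 2.
  by have := divr_ge0 (normr_ge0 K) (ltW p20); lra.
have := bound _ t1; rewrite ler_pdivlMr ?(lt_trans _ t1)//.
rewrite mulrDr mulrC divfK ?gt_eqF// leNgt; apply/negP/negPn.
by have := ler_norm K; lra.
Unshelve. all: by end_near. Qed.

Theorem quantile_limit : exists Y : R -> R,
  [/\ measurable_fun setT Y, forall u, 0 <= Y u &
  forall (f : R -> R) (M : R), continuous f -> (forall x, 0 <= x -> `|f x| <= M) ->
  P.-integrable setT (EFin \o (f \o Y)) /\
  (mean (xs n) f)%:E @[n --> \oo] --> (\int[P]_u (f (Y u))%:E)%E].
Proof.
(* Inverts [y = 1 / (1 + x)]; the maximum matters only on a null set, where it keeps [Y]
   nonnegative. *)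
pose Y u := Num.max 0 (q_lim u `^ (-1) - 1).
have mY : measurable_fun setT Y.
  apply: measurable_maxr => //; apply: measurable_funB => //.
  exact: (measurableT_comp (measurable_powR (-1)) measurable_q_lim).
exists Y; split => // [u|f M cf fM]; first by rewrite le_max lexx.
have mfY : measurable_fun setT (f \o Y).
  by apply: measurableT_comp => //; exact: continuous_measurable_fun.
apply: (@cvg_mean_dominated f (f \o Y) M fM mfY).
- move: ae_q_lim q_lim_gt0; apply: filterS2 => u [u01 qu] ql0 _.
  apply: (@continuous_cvg _ _ _ \oo _ (X ^~ u) f); first exact: cf.
  have YE : Y u = (q_lim u)^-1 - 1.
    rewrite /Y powR_inv1 ?(ltW ql0)//; apply/max_idPr.
    rewrite subr_ge0 invf_ge1//.
    by apply: (cvgr_to_le qu); apply: nearW => n; have /andP[] := q01 n u.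
  rewrite YE (_ : X ^~ u = (fun n => (q n u)^-1 - 1)).
    by apply: cvgB; [apply: cvgV => //; rewrite gt_eqF|exact: cvg_cst].
  by apply/funext => n; rewrite /q invrK addrC addKr.
Qed.

End Quantiles.

(** * The limit measure *)

Section ZeroMeasure.
Variable R : realType.
Local Notation Rpos := (`[0%R : R, +oo[%classic).

Lemma continuous_pos_ext (f : R -> R) : {within Rpos, continuous f} ->
  continuous (fun x : R => f (Num.max 0 x) : R).
Proof.
move=> /subspace_continuousP cf x; rewrite /continuous_at.
have m0 : Rpos (Num.max 0 x) by rewrite /= in_itv/= le_max lexx.
apply/cvgrPdist_lt => e e0; have /cvgrPdist_lt/(_ e e0) H0 := cf _ m0.
have H : \forall y \near Num.max 0 x, Rpos y -> `|f (Num.max 0 x) - f y| < e.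
  by move: H0; rewrite near_withinE.
have cmax : (fun y : R => Num.max 0 y) @ x --> Num.max 0 x.
  apply/cvgrPdist_lt => d d0; have /cvgrPdist_lt/(_ d d0) := @cvg_id _ (nbhs x).
  apply: filterS => y /=; apply: le_lt_trans.
  have a1 := ler_norm (x - y); have a2 := ler_norm (- (x - y)); rewrite normrN in a2.
  by rewrite ler_norml; case: (leP 0 x); case: (leP 0 y) => *; apply/andP; split; lra.
have H2 : \forall y \near x, Rpos (Num.max 0 y) ->
  `|f (Num.max 0 x) - f (Num.max 0 y)| < e := cmax _ H.
apply: filterS H2 => y; apply.
by rewrite /= in_itv/= le_max lexx.
Qed.

Definition czero_locations (p : {poly R}) : seq R := [seq - complex.Re z | z <- czeros p].

Lemma zero_measure_itv n (p : {poly R}) (A : set R) : measurable A ->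
  (0 < n)%N -> size (czeros p) = n ->
  (forall x, x \in czero_locations p -> A x) -> zero_measure n p A = 1%E.
Proof.
move=> mA n0 sz H; rewrite /zero_measure /= /mscale /= /msum.
rewrite (eq_bigr (fun=> 1%E)).
  rewrite sumEFin sumr_const card_ord sz -EFinM mulVf// pnatr_eq0 -lt0n//.
move=> j _; rewrite /= diracE mem_set//; apply: H.
rewrite /czero_locations -(nth_map 0 0 (fun z => - complex.Re z))//.
by rewrite mem_nth// size_map.
Qed.

Lemma ge0_integral_zero_measure n (p : {poly R}) (g : R -> \bar R) (h : R -> R) :
  measurable_fun Rpos g -> (forall x, Rpos x -> (0 <= g x)%E) ->
  (forall x, Rpos x -> g x = (h x)%:E) ->
  size (czeros p) = n -> all (>= 0) (czero_locations p) ->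
  (\int[zero_measure n p]_(x in Rpos) g x = (mean (czero_locations p) h)%:E)%E.
Proof.
move=> mg g0 gh sz pos; rewrite /zero_measure ge0_integral_mscale//=.
rewrite ge0_integral_measure_sum//.
have loc (j : 'I_(size (czeros p))) : Rpos (- complex.Re (czeros p)`_j).
  rewrite /= in_itv/= andbT; apply: (allP pos).
  rewrite /czero_locations -(nth_map 0 0 (fun z => - complex.Re z))//.
  by rewrite mem_nth// size_map.
rewrite (eq_bigr (fun j : 'I_ _ => (h (- complex.Re (czeros p)`_j))%:E)); last first.
  move=> j _; rewrite integral_dirac//= diracE mem_set; last exact: loc.
  by rewrite mul1e gh//; exact: loc.
rewrite sumEFin -EFinM mulrC /mean /czero_locations size_map sz; congr ((_ / _)%:E).
by rewrite big_map (big_nth 0) big_mkord sz.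
Qed.

Lemma integral_zero_measure n (p : {poly R}) (f : R -> R) :
  measurable_fun Rpos f -> size (czeros p) = n -> all (>= 0) (czero_locations p) ->
  (\int[zero_measure n p]_(x in Rpos) (f x)%:E = (mean (czero_locations p) f)%:E)%E.
Proof.
move=> mf sz pos; have mf' : measurable_fun Rpos (EFin \o f) by exact/measurable_EFinP.
rewrite integralE.
rewrite (@ge0_integral_zero_measure n p _ (fun x => Num.max (f x) 0))//; last 2 first.
- exact: measurable_funepos.
- by move=> x _; rewrite funeposE /= EFin_max.
rewrite (@ge0_integral_zero_measure n p _ (fun x => Num.max (- f x) 0))//; last 2 first.
- exact: measurable_funeneg.
- by move=> x _; rewrite funenegE /= EFin_max.
rewrite -EFinB; congr (_%:E); rewrite -[- mean _ _]mulN1r -meanZ -meanD.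
apply: eq_mean => x _; rewrite mulN1r.
by case: (leP (f x) 0) => ?; case: (leP (- f x) 0) => ?; lra.
Qed.

Section Limit.
Variables (xs : nat -> seq R) (K : R).
Hypothesis xs_ge0 : forall n, (0 < n)%N -> all (>= 0) (xs n).
Hypothesis size_xs : forall n, (0 < n)%N -> size (xs n) = n.
Hypothesis cvg_inv : forall t, 0 < t -> t < 1 ->
  cvgn (fun n => mean (xs n) (fun x => (t + x)^-1)).
Hypothesis tight : forall t I, 1 < t ->
  mean (xs n) (fun x => (t + x)^-1) @[n --> \oo] --> I ->
  (1 - (t - 1) * I) ^+ 2 <= K / t.

Theorem limit_measure : exists Z : probability (measurableTypeR R) R,
  prob_on_nonneg Z /\ forall f : R -> R, {within Rpos, continuous f} ->
    (exists M, forall x, 0 <= x -> `|f x| <= M) ->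
    (mean (xs n) f)%:E @[n --> \oo] --> (\int[Z]_(x in Rpos) (f x)%:E)%E.
Proof.
have [Y [mY Y0 lim]] := quantile_limit xs_ge0 size_xs cvg_inv tight.
pose mfY := @isMeasurableFun.Build _ _ (measurableTypeR R) (measurableTypeR R) Y mY.
pose Yf : {mfun measurableTypeR R >-> measurableTypeR R} := HB.pack Y mfY.
pose P := uniform_prob (@ltr01 R) : probability (measurableTypeR R) R.
exists (distribution P Yf); split.
  split; first exact: probability_setT.
  rewrite /distribution /pushforward/= (_ : _ @^-1` _ = setT) ?probability_setT//.
  by apply/seteqP; split => // u _ /=; rewrite in_itv/= andbT.
(* [quantile_limit] is about functions continuous on the whole line, so [f] is continued by its
   value at 0. *)
move=> f cf [M fM]; pose g x := f (Num.max 0 x).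
have cg : continuous g by exact: continuous_pos_ext.
have gE x : 0 <= x -> g x = f x by move=> x0; rewrite /g (max_idPr x0).
have gM x : `|g x| <= M by rewrite /g fM// le_max lexx.
have mg : measurable_fun setT g by exact: continuous_measurable_fun.
have preY : Y @^-1` Rpos = setT.
  by apply/seteqP; split => // u _ /=; rewrite in_itv/= andbT.
have [ig limg] := lim g M cg (fun x _ => gM x).
have -> : (\int[distribution P Yf]_(x in Rpos) (f x)%:E = \int[P]_u (g (Y u))%:E)%E.
  transitivity (\int[distribution P Yf]_(x in Rpos) (g x)%:E)%E.
    apply: eq_integral => x; rewrite inE/= in_itv/= andbT => x0.
    by rewrite gE.
  rewrite /distribution integral_pushforward//=.
  - by rewrite preY.
  - exact/measurable_EFinP.
  - by rewrite preY.
apply: cvg_trans limg; apply: near_eq_cvg; near=> n.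
have n0 : (0 < n)%N by near: n; exact: nbhs_infty_gt.
by congr (_%:E); apply: eq_mean => x /(allP (xs_ge0 n0)) x0; rewrite gE.
Unshelve. all: by end_near. Qed.

End Limit.
End ZeroMeasure.

(** * Stieltjes transform and Lambert function *)

Section Lambert.
Variable R : realType.
Implicit Types (t z w : R[i]).

(** By [e^u >= 1 + u] one has [c = vartheta e^(1/vartheta) >= e], so a real value [z <= -1/e] would
    give [1/t = 1 + z c <= 0]. *)
Lemma lambert_domain_slit (vartheta : R) t : 1 <= vartheta -> slit t ->
  lambert_domain ((t^-1 - 1) / (vartheta * expR vartheta^-1)%:C).
Proof.
move=> v1; have v0 : 0 < vartheta by rewrite (lt_le_trans _ v1).
set c := vartheta * _; have c0 : 0 < c by rewrite mulr_gt0// expR_gt0.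
have cC : c%:C != 0 by rewrite fmorph_eq0 gt_eqF.
apply: contraNnot => -[im0 rele].
set z := _ / _ in im0 rele.
have zle : z <= (- expR (-1))%:C by rewrite lecE/= im0 eqxx.
have ce : 1 <= expR (-1) * c.
  have -> : expR (-1) * c = vartheta * expR (vartheta^-1 - 1).
    by rewrite /c expRD; ring.
  have h := expR_ge1Dx (vartheta^-1 - 1).
  have : vartheta * (1 + (vartheta^-1 - 1)) <= vartheta * expR (vartheta^-1 - 1).
    by rewrite ler_pM2l.
  by rewrite addrC subrK divff ?gt_eqF.
have tE : t^-1 = z * c%:C + 1 by rewrite /z divfK// subrK.
rewrite -invr_le0 tE; apply: (@le_trans _ _ ((- expR (-1))%:C * c%:C + 1)).
  by rewrite lerD2r ler_pM2r// ltcR.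
rewrite -(rmorph1 (real_complex R)) -rmorphM -rmorphD lecR mulNr.
by rewrite addrC subr_le0.
Qed.

(** The set of r up to which the two paths agree is closed by continuity, and open because [w e^w]
    is injective near [psi r], which differs from -1. Hence its supremum is 1. *)
Lemma mulc_cexp_path_uniq (phi psi : R -> R[i]) :
  (forall r : R, 0 <= r <= 1 -> phi r * cexp (phi r) = psi r * cexp (psi r)) ->
  (forall r : R, 0 <= r <= 1 -> psi r != -1) ->
  (forall r : R, 0 <= r <= 1 -> forall e : R, 0 < e -> exists2 d : R, 0 < d &
    forall r' : R, 0 <= r' <= 1 -> `|r' - r| < d ->
      normc (phi r' - phi r) < e /\ normc (psi r' - psi r) < e) ->
  phi 0 = psi 0 -> phi 1 = psi 1.
Proof.
move=> eqn psi1 cont e0.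
pose A := [set r : R | 0 <= r <= 1 /\ forall r', 0 <= r' <= r -> phi r' = psi r'].
have A0 : A 0.
  by split=> [|r']; [rewrite lexx ler01|rewrite -eq_le => /eqP <-].
have {e0}A1 : ubound A 1 by move=> r [/andP[]].
have supA : has_sup A by split; [exists 0|exists 1].
set s := sup A.
have s0 : 0 <= s by apply: ub_le_sup => //; exists 1.
have s1 : s <= 1 by apply: ge_sup => //; exists 0.
have sI : 0 <= s <= 1 by rewrite s0.
have es : phi s = psi s.
  apply/eqP; rewrite -subr_eq0 -normc_eq0; apply/negPn/negP => k0.
  have k0' : 0 < normc (phi s - psi s) / 2 by rewrite divr_gt0// lt_def k0 normc_ge0.
  have [d d0 Hd] := cont s sI _ k0'.
  have [r Ar rs] := sup_adherent d0 supA.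
  have rs' : r <= s by apply: ub_le_sup => //; exists 1.
  have [rI Hr] := Ar.
  have [] := Hd r rI; first by rewrite ler0_norm ?subr_le0// opprB ltrBlDl -ltrBlDr.
  have -> : phi r = psi r by apply: Hr; case/andP: rI => ->; rewrite lexx.
  move=> h1 h2; have := ler_normcD (phi s - psi r) (psi r - psi s).
  rewrite subrKA (normcBC (phi s) (psi r)) => D.
  by lra.
have [d d0 Hd] := mulc_cexp_local_inj (psi1 s sI).
have [d' d'0 Hd'] := cont s sI _ d0.
have near r : 0 <= r <= 1 -> `|r - s| < d' -> phi r = psi r.
  move=> rI rs; have [h1 h2] := Hd' r rI rs.
  by apply: Hd; [rewrite -es|exact: h2|exact: eqn].
have d'2 : d' / 2 < d' by clear es; lra.
have As r : 0 <= r <= 1 -> r < s + d' -> A r.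
  clear es; move=> rI rs; split => // r' /andP[r'0 r'r].
  have r'I : 0 <= r' <= 1 by rewrite r'0 (le_trans r'r)//; case/andP: rI.
  have [sr'|r's] := leP s r'; first by apply: near => //; rewrite ger0_norm ?subr_ge0//; lra.
  have sr0 : 0 < s - r' by rewrite subr_gt0.
  have [x [xI Hx]] := sup_adherent sr0 supA; rewrite opprB addrCA subrr addr0 => xr'.
  by apply: Hx; rewrite r'0 ltW.
have [s1'|] := ltP s 1; last first.
  by move=> s1'; have -> : 1 = s by apply/eqP; rewrite eq_le s1' s1.
pose r := Num.min 1 (s + d' / 2).
have rI : 0 <= r <= 1.
  by rewrite le_min ler01 ge_min lexx/= andbT addr_ge0// divr_ge0// ltW.
have sr : s < r by rewrite lt_min s1' ltrDl divr_gt0.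
have : A r by apply: As => //; rewrite gt_min ltrD2l d'2 orbT.
by move=> /(ub_le_sup (ex_intro _ 1 A1)); rewrite leNgt sr.
Qed.

End Lambert.

(** * The Stieltjes transform of the limit law as a limit of means *)

Section StieltjesLimit.
Variables (R : realType) (xs : nat -> seq R).
Variable Z : {measure set (measurableTypeR R) -> \bar R}.
Hypothesis xs_ge0 : forall n, (0 < n)%N -> all (>= 0) (xs n).
Hypothesis limZ : forall f : R -> R, {within `[0%R : R, +oo[%classic, continuous f} ->
    (exists M, forall x, 0 <= x -> `|f x| <= M) ->
    (mean (xs n) f)%:E @[n --> \oo] --> (\int[Z]_(x in `[0%R : R, +oo[%classic) (f x)%:E)%E.

Let cm n (t : R[i]) : R[i] :=
  mean (xs n) (fun x => complex.Re (t + x%:C)^-1) +i*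
  mean (xs n) (fun x => complex.Im (t + x%:C)^-1).

Lemma cvg_mean_Rintegral (f : R -> R) (L M : R) :
  (forall x y, 0 <= x -> 0 <= y -> `|f x - f y| <= L * `|x - y|) ->
  (forall x, 0 <= x -> `|f x| <= M) ->
  mean (xs n) f @[n --> \oo] --> (\int[Z]_(x in `[0%R : R, +oo[%classic) f x)%R.
Proof.
move=> fL fM; have M0 : 0 <= M by rewrite (le_trans _ (fM 0 _)).
have cf : {within `[0%R : R, +oo[%classic, continuous f}.
  apply/subspace_continuousP => x /=; rewrite in_itv/= andbT => x0.
  apply/cvgrPdist_lt => e e0; rewrite near_withinE.
  have L0 : 0 < `|L| + 1 by rewrite ltr_wpDl.
  have d0 : 0 < e / (`|L| + 1) by rewrite divr_gt0.
  have /cvgrPdist_lt/(_ _ d0) := @cvg_id _ (nbhs x).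
  apply: filterS => y /= xy; rewrite in_itv/= andbT => y0.
  rewrite (le_lt_trans (fL _ _ x0 y0))//; move: xy; rewrite ltr_pdivlMr// mulrC.
  apply: le_lt_trans; rewrite ler_wpM2r// (le_trans (ler_norm _))//.
  by rewrite lerDl.
have lim := limZ cf (ex_intro _ M fM).
have meanM : \forall n \near \oo, `|mean (xs n) f| <= M.
  near=> n; apply: mean_norm_le => // x xn; apply: fM; apply: (allP (xs_ge0 _) _ xn).
  by near: n; exact: nbhs_infty_gt.
(* The real-valued integral is [fine] of the extended one, so finiteness has to be shown; the bound
   [M] on the means passes to the limit. *)
suff fin : (\int[Z]_(x in `[0%R : R, +oo[%classic) (f x)%:E)%E \is a fin_num.
  rewrite -(fineK fin) in lim; exact: (fine_cvg lim).
have le1 : (\int[Z]_(x in `[0%R : R, +oo[%classic) (f x)%:E <= M%:E)%E.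
  apply: (cvge_to_le lim); apply: filterS meanM => n.
  by rewrite lee_fin => /ler_normlP[].
have le2 : ((- M)%:E <= \int[Z]_(x in `[0%R : R, +oo[%classic) (f x)%:E)%E.
  apply: (cvge_to_ge lim); apply: filterS meanM => n.
  by rewrite lee_fin => /ler_normlP[]; rewrite lerNl.
by rewrite fin_numElt (lt_le_trans _ le2) ?ltNyr// (le_lt_trans le1)// ltry.
Unshelve. all: by end_near. Qed.

(** The integral of [1 / (t + x)]: the reflection of the Stieltjes transform that fits zeros written
    as - x. *)
Let S (t : R[i]) : R[i] := - stieltjes Z (- t).

Let resolvent_le (t u : R[i]) (k x y : R) : 0 < k ->
  k <= normc (t + x%:C) -> k <= normc (u + y%:C) ->
  normc ((t + x%:C)^-1 - (u + y%:C)^-1) <= k^-1 ^+ 2 * normc ((u - t) + (y - x)%:C).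
Proof.
move=> k0 kt ku.
have t0 : t + x%:C != 0 by rewrite -normc_gt0 (lt_le_trans k0).
have u0 : u + y%:C != 0 by rewrite -normc_gt0 (lt_le_trans k0).
have -> : (t + x%:C)^-1 - (u + y%:C)^-1 =
    (t + x%:C)^-1 * (u + y%:C)^-1 * ((u - t) + (y - x)%:C).
  by rewrite rmorphB; field; rewrite t0 u0.
rewrite !Normc.normcM !Normc.normcV expr2 ler_wpM2r ?normc_ge0//.
by rewrite ler_pM ?invr_ge0 ?normc_ge0// lef_pV2 ?posrE// (lt_le_trans k0).
Qed.

Let slit_lb t : slit t -> exists2 k : R, 0 < k &
  forall x, 0 <= x -> k <= normc (t + x%:C).
Proof.
move=> /slit_normcD_ge[k k0 H]; exists k => // x x0.
by rewrite (le_trans _ (H x x0))// ler_peMr ?lerDl// ltW.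
Qed.

Lemma cvg_mean_stieltjes (t : R[i]) : slit t -> cm n t @[n --> \oo] --> (S t : R[i]^o).
Proof.
move=> st; have [k k0 kt] := slit_lb st.
have E x : 1 / (- t - x%:C) = - (t + x%:C)^-1 by rewrite div1r -invrN opprD.
have lim (p : R[i] -> R) : (forall z, `|p z| <= normc z) -> (forall z, p (- z) = - p z) ->
    (forall y z, p (y - z) = p y - p z) ->
    mean (xs n) (fun x => p (t + x%:C)^-1) @[n --> \oo] -->
    - (\int[Z]_(x in `[0%R : R, +oo[%classic) p (1 / (- t - x%:C))%R)%R.
  move=> pn pN pB.
  have l : mean (xs n) (fun x => p (1 / (- t - x%:C))) @[n --> \oo] -->
      (\int[Z]_(x in `[0%R : R, +oo[%classic) p (1 / (- t - x%:C))%R)%R.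
    apply: (@cvg_mean_Rintegral _ (k^-1 ^+ 2) k^-1).
      move=> x y x0 y0; rewrite -pB !E -opprB opprK addrC pN normrN.
      rewrite (le_trans (pn _))// (le_trans (resolvent_le k0 (kt _ x0) (kt _ y0)))//.
      by rewrite subrr add0r normcR distrC.
    move=> x x0; rewrite E pN normrN (le_trans (pn _))// Normc.normcV.
    by rewrite lef_pV2 ?posrE ?kt// (lt_le_trans k0) ?kt.
  rewrite (_ : (fun n => _) = (fun n => - mean (xs n) (fun x => p (1 / (- t - x%:C))))).
    exact: (cvgN l).
  apply/funext => n; rewrite -mulN1r -meanZ; apply: eq_mean => x _.
  by rewrite E pN mulN1r opprK.
rewrite /S /stieltjes; set A := (\int[Z]_(x in _) complex.Re _)%R; set B := (\int[Z]_(x in _) _)%R.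
have -> : - (A +i* B) = (- A) +i* (- B) by [].
apply: cvgC_ReIm.
  apply: lim; [exact: ler_normRe|by case|by case=> a b [c d]].
by apply: lim; [exact: ler_normIm|case|case=> a b [c d]].
Qed.

(** The estimate is termwise for the means, with constants independent of n, and passes to the
    limit. If [|t + x| >= k], then [|u + x| >= k / 2] on the disc of radius [k / 2]; the factor 2
    comes from treating real and imaginary parts separately. *)
Lemma stieltjes_locally_lipschitz (t : R[i]) : slit t -> exists d B : R, [/\ 0 < d, 0 <= B &
  forall u, normc (u - t) < d -> slit u /\ normc (S u - S t) <= B * normc (u - t)].
Proof.
move=> st; have [k k0 kt] := slit_lb st.
exists (k / 2), (2 * (k / 2)^-1 ^+ 2); rewrite divr_gt0//; split => //.
  by rewrite mulr_ge0// exprn_ge0// invr_ge0 divr_ge0// ltW.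
move=> u ut; have ku x : 0 <= x -> k / 2 <= normc (u + x%:C).
  move=> /kt kx; have := ler_normcD (u + x%:C) (t - u).
  rewrite (_ : u + x%:C + (t - u) = t + x%:C); last by ring.
  by rewrite (normcBC t); lra.
have su : slit u.
  apply/negP => u0; have := ku (- complex.Re u).
  move: u0; rewrite lecE/= => /andP[/eqP u1 u2]; rewrite oppr_ge0 => /(_ u2).
  rewrite (_ : u + _ = 0) ?Normc.normc0 ?leNgt ?divr_gt0//.
  by case: (u) u1 => a b /= <-; apply/eqP; rewrite eq_complex/= addr0 subrr !eqxx.
split => //; have k2 : 0 < k / 2 by rewrite divr_gt0.
have kt' x : 0 <= x -> k / 2 <= normc (t + x%:C).
  by move=> /kt; apply: le_trans; lra.
set b := (k / 2)^-1 ^+ 2 * normc (u - t).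
have b0 : 0 <= b by rewrite mulr_ge0 ?normc_ge0// exprn_ge0// invr_ge0 ltW.
have comp (p : R[i] -> R) n : (0 < n)%N -> (forall z, `|p z| <= normc z) ->
    (forall y z, p (y - z) = p y - p z) ->
    `|mean (xs n) (fun x => p (u + x%:C)^-1) - mean (xs n) (fun x => p (t + x%:C)^-1)| <= b.
  move=> n0 pn pB; rewrite -[- mean _ _]mulN1r -meanZ -meanD.
  apply: mean_norm_le => // x /(allP (xs_ge0 n0)) x0; rewrite mulN1r -pB.
  rewrite (le_trans (pn _))// (le_trans (resolvent_le k2 (ku _ x0) (kt' _ x0)))//.
  by rewrite subrr addr0 normcBC.
have cmb n : (0 < n)%N -> normc (cm n u - cm n t) <= 2 * b.
  move=> n0; rewrite (le_trans (ler_normcReIm _))// mulr_natl mulr2n lerD//.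
    by apply: comp => //; [exact: ler_normRe|case=> a b' [c d]].
  by apply: comp => //; [exact: ler_normIm|case=> a b' [c d]].
have -> : 2 * (k / 2)^-1 ^+ 2 * normc (u - t) = 2 * b by rewrite /b mulrA.
rewrite leNgt; apply/negP => lt.
pose e := (normc (S u - S t) - 2 * b) / 2.
have e0 : 0 < e by rewrite divr_gt0// subr_gt0.
have /cvgC_normcP/(_ _ e0) cu := cvg_mean_stieltjes su.
have /cvgC_normcP/(_ _ e0) ct := cvg_mean_stieltjes st.
have [N _ HN] : \forall n \near \oo, [/\ (0 < n)%N, normc (cm n u - S u) < e &
    normc (cm n t - S t) < e].
  near=> n; split; [|near: n; exact: cu|near: n; exact: ct].
  by near: n; exact: nbhs_infty_gt.
have [N0 uN tN] := HN N (leqnn N).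
have := cmb N N0.
have := ler_normcD (S u - cm N u) (cm N u - cm N t + (cm N t - S t)).
have := ler_normcD (cm N u - cm N t) (cm N t - S t).
rewrite (_ : S u - cm N u + _ = S u - S t); last by ring.
rewrite (normcBC (S u) (cm N u)); rewrite /e in e0 uN tN; lra.
Unshelve. all: by end_near. Qed.

End StieltjesLimit.

(** * Identification of the Stieltjes transform through the Lambert function *)

Section LimitStieltjes.
Variables (R : realType) (vartheta : R) (xs : nat -> seq R).
Variable Z : {measure set (measurableTypeR R) -> \bar R}.
Variable W0 : R[i] -> R[i].
Hypothesis h1 : 1 <= vartheta.
Hypothesis hW0 : is_lambertW0 W0.
Hypothesis xs_ge0 : forall n, (0 < n)%N -> all (>= 0) (xs n).
Hypothesis size_xs : forall n, (0 < n)%N -> size (xs n) = n.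
Hypothesis xsE : forall n, (0 < n)%N -> exists2 c : R[i], c != 0 &
  sibuya_poly (vartheta * n%:R)%:C n = roots_poly c [seq x%:C | x <- xs n].
Hypothesis limZ : forall f : R -> R, {within `[0%R : R, +oo[%classic, continuous f} ->
    (exists M, forall x, 0 <= x -> `|f x| <= M) ->
    (mean (xs n) f)%:E @[n --> \oo] --> (\int[Z]_(x in `[0%R : R, +oo[%classic) (f x)%:E)%E.

Let S (t : R[i]) : R[i]^o := - stieltjes Z (- t).
Let a (t : R[i]) : R[i]^o := t * (1 + (1 - t) / vartheta%:C * S t).
Let w (t : R[i]) : R[i]^o := (1 - a t) / (vartheta%:C * a t).
(** [z (- t)] is the argument of [W0] in [limit_stieltjes]. *)
Let z (t : R[i]) : R[i]^o := (t^-1 - 1) / (vartheta * expR vartheta^-1)%:C.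

Let v0 : 0 < vartheta. Proof. exact: lt_le_trans h1. Qed.
Let vC : vartheta%:C != 0. Proof. by rewrite fmorph_eq0 gt_eqF// v0. Qed.
Let cC : (vartheta * expR vartheta^-1)%:C != 0.
Proof. by rewrite fmorph_eq0 gt_eqF// mulr_gt0 ?expR_gt0 ?v0. Qed.

Lemma cvg_sratio t : slit t -> sratio (vartheta * n%:R) n t @[n --> \oo] --> a t.
Proof.
move=> st; have cS := cvg_mean_stieltjes xs_ge0 limZ st.
have : t * (1 + (1 - t) / vartheta%:C *
    (mean (xs n) (fun x => complex.Re (t + x%:C)^-1) +i*
     mean (xs n) (fun x => complex.Im (t + x%:C)^-1))) @[n --> \oo] --> a t.
  apply: (@cvgM R[i]); first exact: cvg_cst.
  apply: (@cvgD R[i] R[i]^o); first exact: cvg_cst.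
  by apply: (@cvgM R[i]); [exact: cvg_cst|exact: cS].
apply: cvg_trans; apply: near_eq_cvg; near=> n.
by rewrite (sratio_mean h1 xs_ge0 size_xs xsE)//; near: n; exact: nbhs_infty_gt.
Unshelve. all: by end_near. Qed.

Lemma lim_neq0 t : slit t -> a t != 0.
Proof. by move=> st; have [] := sratio_lim_equation h1 st (cvg_sratio st). Qed.

Lemma lim_cexp t : slit t -> w t * cexp (w t) = z t.
Proof.
move=> st; have [a0 E] := sratio_lim_equation h1 st (cvg_sratio st).
have t0 := slit_neq0 st.
have wE : w t = (vartheta%:C * a t)^-1 + (- vartheta^-1)%:C.
  by rewrite rmorphN fmorphV /w; field; rewrite vC a0.
have eE : (expR vartheta^-1)%:C != 0 by rewrite fmorph_eq0 gt_eqF// expR_gt0.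
rewrite {2}wE cexpD cexpR expRN fmorphV /w /z rmorphM.
have E' : cexp (vartheta%:C * a t)^-1 * (1 - a t) = (1 - t) * a t / t.
  by apply: (mulfI t0); rewrite mulrA -E; field.
rewrite (_ : _ / _ * _ = (cexp (vartheta%:C * a t)^-1 * (1 - a t)) /
   (vartheta%:C * a t) / (expR vartheta^-1)%:C); last by field; rewrite vC a0 eE.
by rewrite E'; field; rewrite ?vC ?a0 ?eE ?t0.
Qed.

Let S_cont t : slit t -> S u @[u --> (t : R[i]^o)] --> S t.
Proof.
move=> st; have [d [B [d0 B0 H]]] := stieltjes_locally_lipschitz xs_ge0 limZ st.
have nt : Filter (nbhs (t : R[i]^o)) by exact: nbhs_filter.
apply: (proj2 (@cvgC_normcP _ _ _ nt _ _)) => e e0.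
have e0' : 0 < Num.min d (e / (B + 1)) by rewrite lt_min d0 divr_gt0// ltr_wpDl.
have := proj1 (@cvgC_normcP _ _ _ nt id t) cvg_id _ e0'.
apply: filterS => u ut; change (normc (S u - S t : R[i]) < e).
have /andP[ud ue] : (normc (u - t) < d) && (normc (u - t) < e / (B + 1)).
  by rewrite -lt_min.
have [_ h] := H u ud; rewrite (le_lt_trans h)//.
move: ue; rewrite ltr_pdivlMr ?ltr_wpDl// mulrC; apply: le_lt_trans.
by rewrite ler_wpM2r ?normc_ge0// lerDl.
Qed.

Let a_cvg T (F : set_system T) (FF : Filter F) (x s : T -> R[i]^o) (t l : R[i]^o) :
  x @ F --> t -> s @ F --> l ->
  x y * (1 + (1 - x y) / vartheta%:C * s y) @[y --> F] -->
  (t * (1 + (1 - t) / vartheta%:C * l) : R[i]^o).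
Proof.
move=> xt sS; apply: (@cvgM R[i]); first exact: xt.
apply: (@cvgD R[i] R[i]^o); first exact: cvg_cst.
apply: (@cvgM R[i]); last exact: sS.
apply: (@cvgM R[i]); last exact: cvg_cst.
by apply: (@cvgB R[i] R[i]^o); [exact: cvg_cst|exact: xt].
Qed.

Let w_cvg T (F : set_system T) (FF : Filter F) (x : T -> R[i]^o) (l : R[i]^o) :
  l != 0 -> x @ F --> l ->
  (1 - x y) / (vartheta%:C * x y) @[y --> F] --> ((1 - l) / (vartheta%:C * l) : R[i]^o).
Proof.
move=> l0 xa; apply: (@cvgM R[i]).
  by apply: (@cvgB R[i] R[i]^o); [exact: cvg_cst|exact: xa].
apply: (@cvgV R[i]); first by rewrite mulf_neq0.
by apply: (@cvgM R[i]); [exact: cvg_cst|exact: xa].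
Qed.

Let z_cvg T (F : set_system T) (FF : Filter F) (x : T -> R[i]^o) (t : R[i]^o) :
  t != 0 -> x @ F --> t ->
  ((x y)^-1 - 1) / (vartheta * expR vartheta^-1)%:C @[y --> F] -->
  ((t^-1 - 1) / (vartheta * expR vartheta^-1)%:C : R[i]^o).
Proof.
move=> t0 xt; apply: (@cvgM R[i]); last exact: cvg_cst.
apply: (@cvgB R[i] R[i]^o); last exact: cvg_cst.
by apply: (@cvgV R[i]); [exact: t0|exact: xt].
Qed.

Let w_cont t : slit t -> w u @[u --> (t : R[i]^o)] --> w t.
Proof.
move=> st; have nt : Filter (nbhs (t : R[i]^o)) by exact: nbhs_filter.
exact: (w_cvg nt (lim_neq0 st) (a_cvg nt cvg_id (S_cont st))).
Qed.

Let Wz_cont t : slit t -> W0 (z u) @[u --> (t : R[i]^o)] --> (W0 (z t) : R[i]^o).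
Proof.
move=> st; have nt : Filter (nbhs (t : R[i]^o)) by exact: nbhs_filter.
have zc : z u @[u --> (t : R[i]^o)] --> z t by exact: (z_cvg nt (slit_neq0 st) cvg_id).
have Wc : {for (z t : R[i]^o), continuous (W0 : R[i]^o -> R[i]^o)}.
  apply: differentiable_continuous; apply/derivable1_diffP.
  exact: (lambertW0_analytic hW0 (lambert_domain_slit h1 st)).
exact: (cvg_comp _ _ zc Wc).
Qed.

Let path (t : R[i]) (r : R) : R[i]^o := 1 + r%:C * (t - 1).

(** The slit plane is star-shaped about 1: if [path t r] were at most 0, so would be
    [r t = path t r - (1 - r)]. *)
Let path_slit t r : slit t -> 0 <= r <= 1 -> slit (path t r).
Proof.
move=> st /andP[r0 r1]; have [->|rn0] := eqVneq r 0.
  by rewrite /path mul0r addr0 /slit ler10.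
have rp : 0 < r%:C by rewrite ltcR lt_def rn0.
apply/negP => p0; move/negP: st; apply.
rewrite -(pmulr_rle0 _ rp).
have -> : r%:C * t = path t r - (1 - r)%:C by rewrite /path rmorphB rmorph1; ring.
by rewrite subr_le0 (le_trans p0)// ler0c subr_ge0.
Qed.

Let path_near (F : R[i] -> R[i]^o) t r : F u @[u --> path t r] --> F (path t r) ->
  forall e : R, 0 < e -> exists2 d : R, 0 < d & forall r' : R, `|r' - r| < d ->
    normc (F (path t r') - F (path t r)) < e.
Proof.
move=> Fc e e0.
have pc : path t x @[x --> r] --> path t r.
  apply/cvgC_normcP => b b0; have c0 : 0 < b / (normc (t - 1) + 1).
    by rewrite divr_gt0// ltr_wpDl// normc_ge0.
  have /cvgrPdist_lt/(_ _ c0) := @cvg_id _ (nbhs r).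
  apply: filterS => x xr; rewrite ltr_pdivlMr ?ltr_wpDl ?normc_ge0// in xr.
  rewrite /path (_ : _ - _ = (x - r)%:C * (t - 1)); last by rewrite rmorphB; ring.
  rewrite Normc.normcM normcR distrC (le_lt_trans _ xr)// ler_wpM2l// lerDl.
  exact: ler01.
have /cvgC_normcP/(_ e e0) := cvg_comp _ _ pc Fc.
rewrite -nbhs_nearE => /nbhs_ballP[d d0 Hd]; exists d => // r' rr'.
by apply: Hd; rewrite /ball/= distrC.
Qed.

Lemma lim_lambert t : slit t -> w t = W0 (z t).
Proof.
move=> st; have p1 : path t 1 = t by rewrite /path mul1r addrC subrK.
have p0 : path t 0 = 1 by rewrite /path mul0r addr0.
rewrite -p1; apply: (@mulc_cexp_path_uniq _ (w \o path t) (W0 \o z \o path t)).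
- move=> r rI /=; have sr := path_slit st rI.
  by rewrite lim_cexp// (lambertW0_eq hW0)//; exact: lambert_domain_slit.
(* The value -1 of [W0] would force [z = -1/e], a point outside the domain. *)
- move=> r rI /=; have dz := lambert_domain_slit h1 (path_slit st rI).
  apply/eqP => W1; have := lambertW0_eq hW0 dz; rewrite -/(z _) W1 => E.
  have E' : z (path t r) = (- expR (-1))%:C.
    by rewrite -E -[-1]/(- (1%:C)) -rmorphN cexpR -rmorphM mulN1r.
  by apply: dz; rewrite -/(z _) E' /=.
- move=> r rI e e0; have sr := path_slit st rI.
  have [d1 d10 H1] := path_near (w_cont sr) e0.
  have [d2 d20 H2] := path_near (Wz_cont sr) e0.
  exists (Num.min d1 d2); first by rewrite lt_min d10.
  by move=> r' _; rewrite lt_min => /andP[/H1 ? /H2 ?].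
(* At [t = 1] the factor [1 - t] gives [a = 1], hence [w = 0]; also [z = 0], where [W0] vanishes. *)
rewrite /= p0 /w /z /a subrr mul0r mul0r addr0 mul1r subrr mul0r invr1 subrr mul0r.
have := lambertW0_inv hW0 (_ : -1 < 0 :> R); by rewrite mul0r => ->//; rewrite ltrN10.
Qed.

Lemma stieltjes_limitE t : ~~ (0 <= t) -> t != -1 ->
  stieltjes Z t = limit_stieltjes W0 vartheta t.
Proof.
move=> t0 t1; have st : slit (- t) by rewrite /slit oppr_le0.
have s0 := slit_neq0 st; rewrite oppr_eq0 in s0.
have a0 := lim_neq0 st.
rewrite /limit_stieltjes.
have -> : (- t^-1 - 1) / (vartheta * expR vartheta^-1)%:C = z (- t).
  by rewrite /z invrN.
rewrite -lim_lambert//=.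
(* As [1 + vartheta w = 1 / a], the quotient is affine in [a], hence in [stieltjes Z t]; solving for
   the latter divides by [t + 1]. *)
have wE : w (- t) / (1 + vartheta%:C * w (- t)) = (1 - a (- t)) / vartheta%:C.
  have -> : 1 + vartheta%:C * w (- t) = (a (- t))^-1 by rewrite /w; field; rewrite vC a0.
  by rewrite /w; field; rewrite vC a0.
rewrite wE rmorphXn /a /S opprK.
have t1' : t + 1 != 0 by rewrite addr_eq0.
by field; rewrite vC s0 t1'.
Qed.

(** Near -1, but not at it, the formula equals the Stieltjes transform, which is continuous at
    -1. *)
Lemma cvg_limit_stieltjes :
  limit_stieltjes W0 vartheta t @[t --> (-1 : R[i]^o)^'] --> (stieltjes Z (-1) : R[i]^o).
Proof.
have s1 : slit (1 : R[i]) by rewrite /slit ler10.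
have [d [B [d0 B0 H]]] := stieltjes_locally_lipschitz xs_ge0 limZ s1.
have nt : Filter (nbhs (-1 : R[i]^o)) by exact: nbhs_filter.
apply/cvgC_normcP => e e0; rewrite /dnbhs near_withinE.
have e0' : 0 < Num.min d (e / (B + 1)) by rewrite lt_min d0 divr_gt0// ltr_wpDl.
have := proj1 (@cvgC_normcP _ _ _ nt id (-1)) cvg_id _ e0'.
apply: filterS => u ut un.
have /andP[ud ue] : (normc (- u - 1) < d) && (normc (- u - 1) < e / (B + 1)).
  rewrite -lt_min -normcN opprD !opprK.
  by have : normc (u - -1) < Num.min d (e / (B + 1)) := ut; rewrite opprK.
have [su h] := H (- u) ud.
rewrite -stieltjes_limitE//; last by move: su; rewrite /slit oppr_le0.
rewrite !opprK addrC -opprB normcN in h.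
rewrite (le_lt_trans h)//; move: ue; rewrite ltr_pdivlMr ?ltr_wpDl// mulrC.
by apply: le_lt_trans; rewrite ler_wpM2r ?normc_ge0// lerDl.
Qed.

End LimitStieltjes.

(** * From [sibuya_poly] to the zeros of [G3] *)

Section Zeros.
Variables (R : realType) (theta : R) (n : nat).
Hypotheses (n0 : (0 < n)%N) (nth : n%:R <= theta).
Let p : {poly R[i]} := map_poly (real_complex R) (G3 n theta).

Let th0 : 0 < theta.
Proof. by rewrite (lt_le_trans _ nth)// ltr0n. Qed.

Let pE : p = ((theta ^+ n)^-1)%:C *: sibuya_poly theta%:C n.
Proof. by rewrite /p G3E// map_polyZ map_sibuya_poly. Qed.

Let k0 : ((theta ^+ n)^-1)%:C != 0.
Proof. by rewrite fmorph_eq0 invr_eq0 expf_neq0// gt_eqF. Qed.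

Let p_neq0 : p != 0.
Proof.
have s1 : slit (1 : R[i]) by rewrite /slit ler10.
by rewrite pE scaler_eq0 negb_or k0; apply: contraTneq (sibuya_poly_neq0 s1 nth) => ->;
  rewrite horner0 eqxx.
Qed.

Lemma root_G3_le0 (z : R[i]) : root p z -> z <= 0.
Proof.
apply: contraLR => sz; have := sibuya_poly_neq0 sz nth.
by apply: contra => /rootP; rewrite pE hornerZ => /eqP; rewrite mulf_eq0 (negPf k0).
Qed.

Let czerosE : p = lead_coef p *: \prod_(z <- czeros (G3 n theta)) ('X - z%:P).
Proof. by rewrite /czeros; case: closed_field_poly_normal. Qed.

Lemma size_czeros_G3 : size (czeros (G3 n theta)) = n.
Proof.
have : size p = n.+1.
  rewrite pE size_scale// size_sibuya_poly// => j jn.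
  rewrite -(rmorph_nat (real_complex R)) (inj_eq (fmorph_inj _)) gt_eqF//.
  by rewrite (lt_le_trans _ nth)// ltr_nat.
rewrite czerosE size_scale ?lead_coef_eq0// size_prod_XsubC => -[].
by [].
Qed.

Lemma czero_locations_G3_ge0 : all (>= 0) (czero_locations (G3 n theta)).
Proof. by have [] := roots_poly_nonpos czerosE p_neq0 root_G3_le0. Qed.

Lemma sibuya_poly_czeros : exists2 c : R[i], c != 0 &
  sibuya_poly theta%:C n = roots_poly c [seq x%:C | x <- czero_locations (G3 n theta)].
Proof.
have [_ e] := roots_poly_nonpos czerosE p_neq0 root_G3_le0.
exists ((((theta ^+ n)^-1)%:C)^-1 * lead_coef p).
  by rewrite mulf_neq0 ?invr_eq0 ?k0// lead_coef_eq0.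
rewrite /roots_poly -scalerA -/(roots_poly _ _) -e pE scalerA mulVf//.
by rewrite scale1r.
Qed.

Lemma prob_zero_measure_G3 : prob_on_nonneg (zero_measure n (G3 n theta)).
Proof.
split; apply: zero_measure_itv => //; rewrite ?size_czeros_G3//.
by move=> x /(allP czero_locations_G3_ge0) x0; rewrite /= in_itv/= x0.
Qed.

End Zeros.

Theorem proposition2p19 (R : realType) (vartheta : R) (h : 1 <= vartheta)
    (W0 : R[i] -> R[i]) (hW0 : is_lambertW0 W0) :
  let P := fun n : nat => G3 n (vartheta * n%:R) in
  let mu := fun n : nat => zero_measure n (P n) in
  (forall n : nat, (0 < n)%N ->
     (forall z : R[i], root (map_poly (real_complex R) (P n)) z ->
        complex.Im z = 0 /\ complex.Re z <= 0)
     /\ prob_on_nonneg (mu n)) /\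
  exists Z : probability (measurableTypeR R) R,
    [/\ prob_on_nonneg Z,
        weak_cvg_nonneg mu Z,
        (forall t : R[i], ~~ (0 <= t) -> t != -1 ->
           stieltjes Z t = limit_stieltjes W0 vartheta t) &
        limit_stieltjes W0 vartheta t @[t --> (-1 : R[i]^o)^']
          --> (stieltjes Z (-1) : R[i]^o)].
Proof.
move=> P mu; have nth n := natr_le_scale h n.
pose xs n := czero_locations (P n).
have xs_ge0 n (n0 : (0 < n)%N) : all (>= 0) (xs n).
  exact: (czero_locations_G3_ge0 n0 (nth n)).
have size_xs n (n0 : (0 < n)%N) : size (xs n) = n.
  by rewrite size_map; exact: (size_czeros_G3 n0 (nth n)).
have xsE n (n0 : (0 < n)%N) := sibuya_poly_czeros n0 (nth n).
split.
  move=> n n0; split; last exact: (prob_zero_measure_G3 n0 (nth n)).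
  move=> z /(root_G3_le0 n0 (nth n)); rewrite lecE => /andP[/eqP z0 z1].
  by rewrite -z0.
have [Z [pZ limZ]] := limit_measure xs_ge0 size_xs
  (cvg_mean_inv h xs_ge0 size_xs xsE) (cvg_mean_le h xs_ge0 size_xs xsE).
exists Z; split => //.
- move=> f cf bf; apply: cvg_trans (limZ f cf bf); apply: near_eq_cvg; near=> n.
  have n0 : (0 < n)%N by near: n; exact: nbhs_infty_gt.
  rewrite /mu integral_zero_measure//.
  + exact: subspace_continuous_measurable_fun.
  + exact: (size_czeros_G3 n0 (nth n)).
  + exact: xs_ge0.
- by move=> t t0 t1; exact: (stieltjes_limitE h hW0 xs_ge0 size_xs xsE limZ).
- exact: (cvg_limit_stieltjes h hW0 xs_ge0 size_xs xsE limZ).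
Unshelve. all: by end_near. Qed.
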